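(* For integers $n\geq m\geq 1$ let $h(n,m)=\operatorname{hdepth}(S_{n,m}/I_{n,m})$, where $S_{n,m}=K[x_1,\ldots,x_n,y_1,\ldots,y_m]$ and $I_{n,m}=(x_iy_j : 1\leq i\leq n,\ 1\leq j\leq m)$. Let $n\geq 1$ be an integer. Then: (1) $h(n,m)\geq h(n,m')$, for all integers $1\leq m\leq m'\leq \left\lfloor \frac{n}{2} \right\rfloor$. (2) $h(n,m)\leq h(n,m')$, for all integers $\left\lceil \frac{n}{2} \right\rceil \leq m\leq m'\leq n$. (3) If $n\geq 2$, then $h\left(n,\left\lfloor \frac{n}{2} \right\rfloor\right)=h\left(n,\left\lceil \frac{n}{2} \right\rceil\right)=\left\lceil \frac{n}{2} \right\rceil$. (4) $h(n,m)\geq h(n,n-m)$, for all integers $1\leq m\leq \left\lfloor \frac{n}{2} \right\rfloor$. (5) $\left\lfloor \frac{n}{2} \right\rfloor\leq h(n,m)\leq h(n,1)$, for all integers $1\leq m\leq n$.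
   Context: $K$ is a field. Polynomial rings over $K$ carry the standard grading (each variable has degree 1). For a finitely generated graded module $M$ over a polynomial ring $S$ over $K$, the Hilbert depth $\operatorname{hdepth}(M)$ is the maximal depth of a finitely generated graded $S$-module $N$ having the same Hilbert series as $M$. *)

(* Defs.v *)
From HB Require Import structures.
From mathcomp Require Import all_boot all_order all_algebra.
From mathcomp Require Import mpoly.
From mathcomp Require Import boolp classical_sets.

Set Implicit Arguments.
Unset Strict Implicit.
Unset Printing Implicit Defensive.

Import GRing.Theory.

Local Open Scope ring_scope.
Local Open Scope classical_set_scope.
Local Open Scope quotient_scope.

(* fs M, where fs also stands for the ideal generated by the sequence. *)
Definition ideal_mul (R : nzRingType) (M : lmodType R) (fs : seq R) : set M :=
  [set v | exists u : nat -> M, v = \sum_(i < size fs) fs`_i *: u i].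

Record gradedModule (K : fieldType) (k : nat) := GradedModule {
  gm_carrier :> lmodType {mpoly K[k]};
  gm_piece : int -> set gm_carrier;
  gm_piece0 : forall d, gm_piece d 0;
  gm_pieceD : forall d u v,
    gm_piece d u -> gm_piece d v -> gm_piece d (u + v);
  (* The case e = 0 makes every piece a K-subspace. *)
  gm_pieceZ : forall (e : nat) d (p : {mpoly K[k]}) v,
    p \is e.-homog -> gm_piece d v -> gm_piece (e%:Z + d) (p *: v);
  gm_sum : forall v, exists (s : seq int) (u : int -> gm_carrier),
    (forall d, gm_piece d (u d)) /\ v = \sum_(d <- s) u d;
  gm_direct : forall (s : seq int) (u : int -> gm_carrier),
    uniq s -> (forall d, gm_piece d (u d)) -> \sum_(d <- s) u d = 0 ->
    forall d, d \in s -> u d = 0 }.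

Section GradedModuleInvariants.
Variables (K : fieldType) (k : nat).
Implicit Types M N : gradedModule K k.

Definition finitely_generated M : Prop :=
  exists gs : seq M, forall v, exists c : nat -> {mpoly K[k]},
    v = \sum_(i < size gs) c i *: gs`_i.

Definition is_basis M (A : set M) (r : nat) (b : 'I_r -> M) : Prop :=
  [/\ forall i, A (b i),
      forall c : 'I_r -> K,
        \sum_i (c i)%:MP *: b i = 0 -> forall i, c i = 0 &
      forall v, A v -> exists c : 'I_r -> K, v = \sum_i (c i)%:MP *: b i].

(* The coefficients of the Hilbert series; the default value 0 of xget is only
   used for infinite-dimensional pieces, which do not occur in finitely
   generated modules. *)
Definition hilbert_series M (d : int) : nat :=
  xget 0%N [set r | exists b : 'I_r -> M, is_basis (gm_piece d) b].

Definition regular_seq M (fs : seq {mpoly K[k]}) : Prop :=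
  (forall i v, (i < size fs)%N ->
     ideal_mul (take i fs) (fs`_i *: v) ->
     ideal_mul (take i fs) (v : M)) /\
  exists v : M, ~ ideal_mul fs v.

(* Regular sequences are taken in the graded maximal ideal; their elements need
   not be homogeneous.  A nonempty bounded set of natural numbers contains its
   supremum, so supremum is a maximum here and in hdepth. *)
Definition depth M : nat :=
  supremum 0%N
    [set r | exists fs, [/\ {in fs, forall f : {mpoly K[k]}, f@_0%MM = 0},
                            regular_seq M fs & r = size fs]].

Definition hdepth M : nat :=
  supremum 0%N
    [set r | exists N, [/\ finitely_generated N,
                           hilbert_series N = hilbert_series M &
                           r = depth N]].

End GradedModuleInvariants.

Section QuotientByHomogeneousIdeal.
Variables (K : fieldType) (k : nat) (gs : seq {mpoly K[k]}).
Local Notation S := {mpoly K[k]}.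

Definition ideal_pred : {pred S} := fun p : S => `[< @ideal_mul S S^o gs p >].

Lemma ideal_predP (p : S) :
  reflect (exists u : nat -> S, p = \sum_(i < size gs) gs`_i * u i)
          (p \in ideal_pred).
Proof. exact: asboolP. Qed.

Lemma ideal_pred_zmod_closed : zmod_closed ideal_pred.
Proof.
split=> [|p q /ideal_predP[u ->] /ideal_predP[v ->]]; apply/ideal_predP.
  by exists (fun _ => 0); rewrite big1 // => i _; rewrite mulr0.
exists (fun i => u i - v i); rewrite -sumrB; apply: eq_bigr => i _.
by rewrite mulrBr.
Qed.

HB.instance Definition _ := GRing.isZmodClosed.Build S ideal_pred
  ideal_pred_zmod_closed.

Lemma ideal_predM (p q : S) : q \in ideal_pred -> p * q \in ideal_pred.
Proof.
move=> /ideal_predP[u ->]; apply/ideal_predP; exists (fun i => p * u i).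
by rewrite mulr_sumr; apply: eq_bigr => i _; rewrite mulrCA.
Qed.

Definition quot_mod : Type := Quotient.quot ideal_pred.
HB.instance Definition _ := GRing.Zmodule.on quot_mod.

Definition to_quot (p : S) : quot_mod := \pi_(Quotient.quot ideal_pred) p.

Lemma to_quotB p q : to_quot (p - q) = to_quot p - to_quot q.
Proof. exact: (raddfB \pi_(Quotient.quot ideal_pred)). Qed.

HB.instance Definition _ :=
  GRing.isZmodMorphism.Build S quot_mod to_quot to_quotB.

Lemma to_quot_eq0 p : (to_quot p = 0) <-> (p \in ideal_pred).
Proof.
rewrite -[X in X \in _]subr0 Quotient.idealrBE.
rewrite -(raddf0 to_quot); split; first by move=> /eqP.
by move=> /eqP.
Qed.

Lemma to_quot_surj v : exists p, v = to_quot p.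
Proof. by exists (repr (v : Quotient.quot ideal_pred)); rewrite /to_quot reprK. Qed.

Definition quot_scale (p : S) (v : quot_mod) : quot_mod :=
  to_quot (p * repr (v : Quotient.quot ideal_pred)).

Lemma quot_scaleE p q : quot_scale p (to_quot q) = to_quot (p * q).
Proof.
apply/subr0_eq; rewrite /quot_scale -raddfB -mulrBr; apply/to_quot_eq0.
apply: ideal_predM; apply/to_quot_eq0; rewrite raddfB /=; apply/eqP.
by rewrite subr_eq0 /to_quot reprK.
Qed.

Fact quot_scaleA p q v : quot_scale p (quot_scale q v) = quot_scale (p * q) v.
Proof.
by have [r ->] := to_quot_surj v; rewrite !quot_scaleE mulrA.
Qed.
Fact quot_scale1 : left_id 1 quot_scale.
Proof. by move=> v; have [r ->] := to_quot_surj v; rewrite quot_scaleE mul1r. Qed.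
Fact quot_scaleDr : right_distributive quot_scale +%R.
Proof.
move=> p u v; have [q ->] := to_quot_surj u; have [r ->] := to_quot_surj v.
by rewrite -raddfD !quot_scaleE mulrDr raddfD.
Qed.
Fact quot_scaleDl v : {morph quot_scale^~ v : p q / p + q}.
Proof.
by move=> p q; have [r ->] := to_quot_surj v; rewrite !quot_scaleE mulrDl raddfD.
Qed.

HB.instance Definition _ := GRing.Zmodule_isLmodule.Build S quot_mod
  quot_scaleA quot_scale1 quot_scaleDr quot_scaleDl.

Definition poly_piece (d : int) : set S :=
  [set p | if d is Posz e then p \is e.-homog : Prop else p = 0].

Definition quot_piece (d : int) : set quot_mod := to_quot @` poly_piece d.

Hypothesis gs_homog : {in gs, forall g, g \is homog mdeg}.

Lemma poly_piece0 d : poly_piece d 0.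
Proof. by case: d => d //=; exact: dhomog0. Qed.

Lemma poly_pieceD d p q : poly_piece d p -> poly_piece d q -> poly_piece d (p + q).
Proof. by case: d => d /=; [exact: dhomogD | move=> -> ->; rewrite addr0]. Qed.

Lemma quot_piece0 d : quot_piece d 0.
Proof. by exists 0; [exact: poly_piece0 | rewrite raddf0]. Qed.

Lemma quot_pieceD d u v :
  quot_piece d u -> quot_piece d v -> quot_piece d (u + v).
Proof.
by move=> [p hp <-] [q hq <-]; exists (p + q); [exact: poly_pieceD|rewrite raddfD].
Qed.

Lemma quot_pieceZ (e : nat) d (p : S) v :
  p \is e.-homog -> quot_piece d v -> quot_piece (e%:Z + d) (p *: v).
Proof.
move=> hp [q hq <-]; rewrite [p *: _]quot_scaleE.
case: d hq => d hq; first by exists (p * q) => //; exact: dhomogM.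
by rewrite (hq : q = 0) mulr0 raddf0; exact: quot_piece0.
Qed.

Lemma quot_sum v : exists (s : seq int) (u : int -> quot_mod),
  (forall d, quot_piece d (u d)) /\ v = \sum_(d <- s) u d.
Proof.
have [p ->] := to_quot_surj v.
exists (map Posz (index_iota 0 (mmeasure mdeg p))).
exists (fun d => if d is Posz e then to_quot (pihomog mdeg e p) else 0); split.
  by case=> e; [exists (pihomog mdeg e p) => //; exact: pihomogP|exact: quot_piece0].
rewrite big_map -raddf_sum /=; congr to_quot.
by rewrite big_mkord -pihomog_partitionE.
Qed.

Lemma pihomog_mul (e d : nat) (g p : S) : g \is e.-homog ->
  pihomog mdeg d (g * p) =
  g * (if (e <= d)%N then pihomog mdeg (d - e)%N p else 0).
Proof.
move=> hg; rewrite {1}(pihomog_partitionE (leqnn (mmeasure mdeg p))).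
rewrite mulr_sumr raddf_sum /=.
have prodE (j : nat) : pihomog mdeg d (g * pihomog mdeg j p) =
    if (e + j == d)%N then g * pihomog mdeg j p else 0.
  have hj : g * pihomog mdeg j p \is (e + j).-homog.
    by apply: dhomogM => //; exact: pihomogP.
  by case: eqVneq hj => [-> /pihomog_dE|ne /(pihomog_ne0 ne)].
under eq_bigr => j _ do rewrite prodE.
case: leqP => [le_ed|lt_de]; last first.
  rewrite mulr0 big1 // => j _; case: eqP => // edj.
  by move: lt_de; rewrite -edj ltnNge leq_addr.
rewrite -big_mkcond /=.
have eqE j : (e + j == d)%N = (j == d - e)%N by rewrite -{1}(subnKC le_ed) eqn_add2l.
under eq_bigl => j do rewrite eqE.
have [lt|ge] := ltnP (d - e) (mmeasure mdeg p).
  by rewrite (big_pred1 (Ordinal lt)).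
rewrite big_pred0 => [|j]; last by apply: ltn_eqF; exact: leq_trans ge.
rewrite pihomogE big1_seq ?mulr0 // => m /andP[/eqP dm mp].
by move: (mmeasure_mnm_lt mdeg mp); rewrite dm ltnNge ge.
Qed.

Lemma ideal_pred_pihomog d p : p \in ideal_pred -> pihomog mdeg d p \in ideal_pred.
Proof.
move=> /ideal_predP[u ->]; rewrite raddf_sum /=; apply: rpred_sum => i _.
have /homogP[e he] := gs_homog (mem_nth 0 (ltn_ord i)).
rewrite (pihomog_mul _ _ he) mulrC; apply: ideal_predM; apply/ideal_predP.
exists (fun j => (j == i :> nat)%:R).
rewrite (bigD1 i) //= eqxx mulr1 big1 ?addr0 // => j ji.
by rewrite (negPf (ji : (j : nat) != i)) mulr0.
Qed.

Lemma quot_direct (s : seq int) (u : int -> quot_mod) :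
  uniq s -> (forall d, quot_piece d (u d)) -> \sum_(d <- s) u d = 0 ->
  forall d, d \in s -> u d = 0.
Proof.
move=> us hu.
have /choice[q hq] d : exists p, poly_piece d p /\ to_quot p = u d.
  by have [p] := hu d; exists p.
under eq_bigr => d _ do rewrite -(hq d).2.
rewrite -raddf_sum => /to_quot_eq0 hs d ds.
rewrite -(hq d).2; apply/to_quot_eq0.
case: d ds => e es; last by rewrite ((hq (Negz e)).1 : _ = 0) rpred0.
have /(ideal_pred_pihomog e) := hs.
rewrite raddf_sum (bigD1_seq (Posz e)) //= (pihomog_dE (hq (Posz e)).1).
rewrite big1 ?addr0 // => -[f|f] /= fe.
  by apply: pihomog_ne0 (hq (Posz f)).1; apply: contra_neq fe => ->.
by rewrite ((hq (Negz f)).1 : _ = 0) raddf0.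
Qed.

Definition quot_graded : gradedModule K k :=
  GradedModule quot_piece0 quot_pieceD quot_pieceZ quot_sum quot_direct.

End QuotientByHomogeneousIdeal.

Section HilbertDepthOfEdgeIdeal.
Variables (K : fieldType) (n m : nat).

(* In {mpoly K[n + m]}, x_i is 'X_(lshift m i) and y_j is 'X_(rshift n j). *)
Definition xy_gens : seq {mpoly K[n + m]} :=
  [seq 'X_(lshift m i) * 'X_(rshift n j) | i <- enum 'I_n, j <- enum 'I_m].

Lemma xy_gens_homog : {in xy_gens, forall g, g \is homog mdeg}.
Proof.
move=> g /allpairsP[[i j] /= [_ _ ->]]; apply/homogP; exists 2%N.
by apply: (@dhomogM _ _ _ 1%N _ 1%N); rewrite dhomogX /= mdeg1.
Qed.

Definition h : nat := hdepth (quot_graded xy_gens_homog).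

End HilbertDepthOfEdgeIdeal.

(* Main.v *)
(* h(n,m) is the largest r such that (1 - t)^r H(t) has nonnegative coefficients,
   where H(t) = 1/(1 - t)^n + 1/(1 - t)^m - 1 is the Hilbert series of S/I; the
   theorem then reduces to inequalities between binomial coefficients.

   Upper bound: let a_1, ..., a_r be a regular sequence on N, not necessarily
   homogeneous, in the ideal of the variables x_l, and let
   f_s = sum_l t_s^l x_l with indeterminates t_1, ..., t_r.  By McCoy's argument
   f_s is regular modulo any part of the sequence that leaves some a_i regular,
   so the a_i can be exchanged for the f_s one at a time.  Hence f_1, ..., f_r is
   a regular sequence of linear forms on N[t_1, ..., t_r], and over the fraction
   field of K[t_1, ..., t_r] the quotients have Hilbert series (1 - t)^s H_N.

   Lower bound: if (1 - t)^r H is nonnegative, it is a finite sum of series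
   t^s/(1 - t)^e, so H is the Hilbert series of a finite direct sum of shifted
   modules S/(x_l : l >= c) with c >= r, on which x_0, ..., x_(r-1) is regular. *)

(* The sequence that computes the depth need not be homogeneous, so the quotients by it carry no
   grading and say nothing directly about Hilbert series; over a finite field there may be no
   regular linear form to put in its place. Parameters remove both obstacles, and one per form is
   enough: the top powers of t_s isolate the variables one after another. No quotient module and no
   module over the fraction field is built. N[t] is a set of finitely supported functions,
   regularity is an implication between memberships in spans, and the fraction field enters only
   through ranks of matrices, degree by degree.

   On the numerical side, for r <= n only even degrees can fail to be nonnegative, and degree 2
   alone gives every upper bound. The contribution of m to (1 - t)^r H has nonnegative coefficients
   for r <= m, but is the alternating polynomial (1 - t)^(r - m) for r > m. Each comparison between
   two values of m therefore needs to know on which side of r they lie, so the bounds h >=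
   ceil(n/2), and h <= m for m >= ceil(n/2), are established before the monotonicity statements. *)
From HB Require Import structures.
From mathcomp Require Import all_boot all_order all_algebra.
From mathcomp Require Import ssrcomplements mpoly.
From mathcomp Require Import boolp classical_sets functions.
From mathcomp Require Import zify.
Require Import Defs.

Set Implicit Arguments.
Unset Strict Implicit.
Unset Printing Implicit Defensive.

Import Order.TTheory GRing.Theory Num.Theory.

Local Open Scope ring_scope.
Local Open Scope quotient_scope.

(** * Power series with integer coefficients *)

Section PowerSeries.
Implicit Types (f g : nat -> int) (n m r s d : nat).

(* Multiplication by 1 - t on power series. *)
Definition diff f d : int := f d - (if d is e.+1 then f e else 0).

(* Coefficients of (1 - t) ^- s and of (1 - t) ^ s. *)
Definition poly_dim s d : int := 'C((s + d).-1, d)%:Z.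
Definition alt_bin s d : int := (-1) ^+ d * 'C(s, d)%:Z.

Definition shift s f d : int := if (s <= d)%N then f (d - s)%N else 0.

(** The truncated predecessor makes [poly_dim 0] the series 1, so it also serves as the constant 1
    in [edge_dim]. *)
Lemma poly_dim0 d : poly_dim 0 d = (d == 0%N)%:R.
Proof. by case: d => [|d]; rewrite /poly_dim ?bin0 // add0n bin_small. Qed.

Lemma diff_poly_dim s : diff (poly_dim s.+1) =1 poly_dim s.
Proof.
case=> [|d]; first by rewrite /diff /poly_dim !bin0 subr0.
by rewrite /diff /poly_dim !addSn !addnS /= binS PoszD addrK.
Qed.

Lemma diff_alt_bin s : diff (alt_bin s) =1 alt_bin s.+1.
Proof.
case=> [|d]; first by rewrite /diff /alt_bin !bin0 subr0.
by rewrite /diff /alt_bin binS PoszD exprS mulN1r !mulNr mulrDr opprD.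
Qed.

Lemma eq_diff f g : f =1 g -> diff f =1 diff g.
Proof. by move=> fg d; rewrite /diff fg; case: d => // d; rewrite fg. Qed.

Lemma eq_iter_diff r f g : f =1 g -> iter r diff f =1 iter r diff g.
Proof. by move=> fg; elim: r => //= r IH; exact: eq_diff. Qed.

Lemma diff_inj f g : diff f =1 diff g -> f =1 g.
Proof.
move=> h; elim=> [|d IH]; first by move: (h 0%N); rewrite /diff !subr0.
by move: (h d.+1); rewrite /diff IH => /addIr.
Qed.

Lemma iter_diff_inj r f g : iter r diff f =1 iter r diff g -> f =1 g.
Proof. by elim: r => //= r IH /diff_inj. Qed.

Lemma diffD f g : diff (fun d => f d + g d) =1 fun d => diff f d + diff g d.
Proof. by case=> [|d]; rewrite /diff; lia. Qed.

Lemma diffN f : diff (fun d => - f d) =1 fun d => - diff f d.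
Proof. by case=> [|d]; rewrite /diff; lia. Qed.

Lemma diff_sum (I : Type) (l : seq I) (F : I -> nat -> int) :
  diff (fun d => \sum_(i <- l) F i d) =1 fun d => \sum_(i <- l) diff (F i) d.
Proof. by case=> [|d]; rewrite /diff sumrB ?big1_eq. Qed.

Lemma iter_diffD r f g :
  iter r diff (fun d => f d + g d) =1 fun d => iter r diff f d + iter r diff g d.
Proof. by elim: r => //= r IH d; rewrite (eq_diff IH) diffD. Qed.

Lemma iter_diffN r f : iter r diff (fun d => - f d) =1 fun d => - iter r diff f d.
Proof. by elim: r => //= r IH d; rewrite (eq_diff IH) diffN. Qed.

Lemma iter_diff_sum r (I : Type) (l : seq I) (F : I -> nat -> int) :
  iter r diff (fun d => \sum_(i <- l) F i d) =1
  fun d => \sum_(i <- l) iter r diff (F i) d.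
Proof. by elim: r => //= r IH d; rewrite (eq_diff IH) diff_sum. Qed.

Lemma diff_shift s f : diff (shift s f) =1 shift s (diff f).
Proof.
case=> [|d]; rewrite /diff /shift; first by case: s.
case: (ltngtP s d.+1) => [lt|gt|->]; last by rewrite subnn ltnn.
  by rewrite -ltnS lt subSn.
by rewrite leqNgt (ltn_trans _ gt) // subr0.
Qed.

Lemma eq_shift s f g : f =1 g -> shift s f =1 shift s g.
Proof. by move=> fg d; rewrite /shift fg. Qed.

Lemma iter_diff_shift r s f : iter r diff (shift s f) =1 shift s (iter r diff f).
Proof. by elim: r => //= r IH d; rewrite (eq_diff IH) diff_shift. Qed.

Lemma iter_diff_poly_dim r s : iter r diff (poly_dim (r + s)) =1 poly_dim s.
Proof.
elim: r s => [|r IH] s d; first by rewrite add0n.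
rewrite iterSr (eq_iter_diff r (g := poly_dim (r + s))) => [|e]; first exact: IH.
by rewrite addSn diff_poly_dim.
Qed.

Lemma iter_diff_alt_bin r s : iter r diff (alt_bin s) =1 alt_bin (r + s).
Proof. by elim: r => //= r IH d; rewrite (eq_diff IH) diff_alt_bin. Qed.

(* Coefficients of (1 - t) ^ (r - s). *)
Definition power_coef s r d :=
  if (r <= s)%N then poly_dim (s - r) d else alt_bin (r - s) d.

(** The series 1 is both [poly_dim 0] and [alt_bin 0]; it joins the range of negative exponents of 1
    - t to the range of positive ones. *)
Lemma iter_diff_power s r : iter r diff (poly_dim s) =1 power_coef s r.
Proof.
move=> d; rewrite /power_coef; case: leqP => [le|/ltnW le].
  by rewrite -{1}(subnKC le) iter_diff_poly_dim.
rewrite -{1}(subnK le) iterD (eq_iter_diff _ (g := alt_bin 0)) => [|e].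
  by rewrite iter_diff_alt_bin addn0.
rewrite -{2}[s]addn0 iter_diff_poly_dim poly_dim0 /alt_bin.
by case: e => [|e]; rewrite ?bin0 ?expr0 ?mul1r // bin0n mulr0.
Qed.

(* Coefficients of 1 / (1 - t) ^ n + 1 / (1 - t) ^ m - 1. *)
Definition edge_dim n m d : int := poly_dim n d + poly_dim m d - poly_dim 0 d.

Definition positive n m r : Prop := forall d, 0 <= iter r diff (edge_dim n m) d.

Lemma iter_diff_edge_dim n m r d :
  iter r diff (edge_dim n m) d = power_coef n r d + power_coef m r d - alt_bin r d.
Proof.
rewrite (iter_diffD r _ (fun d => - poly_dim 0 d)) iter_diffN iter_diffD.
rewrite !iter_diff_power; congr (_ - _).
by case: r => [|r]; rewrite /power_coef //= poly_dim0 /alt_bin; case: d => // d;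
  rewrite bin0n mulr0.
Qed.

Lemma positiveP n m r :
  positive n m r <-> forall d, 0 <= power_coef n r d + power_coef m r d - alt_bin r d.
Proof. by split=> h d; move: (h d); rewrite iter_diff_edge_dim. Qed.

(** Division by 1 - t takes partial sums, which preserves nonnegativity. Hence [positive] is
    downward closed in r, and failure at a single exponent excludes all larger ones. *)
Lemma diff_ge0 f : (forall d, 0 <= diff f d) -> forall d, 0 <= f d.
Proof.
move=> h; elim=> [|d IH]; first by move: (h 0%N); rewrite /diff subr0.
by rewrite (le_trans IH) // -subr_ge0; exact: (h d.+1).
Qed.

Lemma positive_le n m r r' : (r' <= r)%N -> positive n m r -> positive n m r'.
Proof.
by elim: r => [|r IH]; [rewrite leqn0 => /eqP ->|rewrite leq_eqVlt => /predU1P[->//|];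
   rewrite ltnS => /IH h /diff_ge0].
Qed.

(** * Binomial inequalities behind the bounds and comparisons *)

Lemma alt_bin_odd s d : odd d -> alt_bin s d = - 'C(s, d)%:Z.
Proof. by move=> od; rewrite /alt_bin -signr_odd od mulN1r. Qed.

Lemma alt_bin_even s d : ~~ odd d -> alt_bin s d = 'C(s, d)%:Z.
Proof. by move=> od; rewrite /alt_bin -signr_odd (negPf od) mul1r. Qed.

Lemma leq_bin2l a b d : (a <= b)%N -> ('C(a, d) <= 'C(b, d))%N.
Proof.
move=> /subnK <-; elim: (b - a)%N => // c IH; rewrite addSn (leq_trans IH) //.
by case: d {IH} => [|d]; rewrite ?bin0 // binS leq_addr.
Qed.

Lemma poly_dim_leq s s' d : (s <= s')%N -> poly_dim s d <= poly_dim s' d.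
Proof. by move=> le; rewrite lez_nat leq_bin2l //; lia. Qed.

(** In odd degree the term [- alt_bin r] contributes +C(r, d), which absorbs the only possible
    negative term, -C(r - m, d). *)
Lemma power_coef_odd n m r d : (r <= n)%N -> odd d ->
  0 <= power_coef n r d + power_coef m r d - alt_bin r d.
Proof.
move=> le od; rewrite /power_coef le (alt_bin_odd r) // opprK.
case: leqP => _; first by rewrite !addr_ge0.
rewrite alt_bin_odd // -addrA addr_ge0 // addrC subr_ge0 lez_nat.
by rewrite leq_bin2l // leq_subr.
Qed.

Lemma power_coef_even_ge0 m r d : ~~ odd d -> 0 <= power_coef m r d.
Proof. by move=> od; rewrite /power_coef; case: leqP => // _; rewrite alt_bin_even. Qed.

(** Odd degrees are settled by [power_coef_odd], and the coefficient in degree 0 is 1 + 1 - 1. *)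
Lemma positive_half n m r : (r <= n)%N ->
  (forall d, ~~ odd d -> (0 < d)%N ->
     0 <= power_coef n r d + power_coef m r d - alt_bin r d) -> positive n m r.
Proof.
move=> le h; apply/positiveP => d.
have [od|od] := boolP (odd d); first exact: power_coef_odd.
case: d od => [_|d od]; last exact: h.
by rewrite /power_coef /alt_bin /poly_dim !bin0; case: ifP; case: ifP.
Qed.

Lemma poly_dim_ge_bin s r d :
  (0 < d)%N -> (r <= s + d.-1)%N -> 'C(r, d)%:Z <= poly_dim s d.
Proof. by case: d => // d _ le; rewrite lez_nat leq_bin2l // addnS. Qed.

(** The term of n alone outweighs C(r, d) as soon as r <= n - r + d - 1. For even d >= 2 this
    follows from 2r <= n + 1, that is, from r <= ceil(n/2). *)
Lemma positive_uphalf n m : positive n m (uphalf n).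
Proof.
have le : (uphalf n <= n)%N by lia.
apply: positive_half => // d od d0.
rewrite addrAC addr_ge0 ?power_coef_even_ge0 //.
rewrite /power_coef le (alt_bin_even (uphalf n)) // subr_ge0 poly_dim_ge_bin //.
by move: d0 od; case: d => // -[|d] //; lia.
Qed.

Lemma bin2E a : ('C(a.+1, 2) = 'C(a, 2) + a)%N.
Proof. by rewrite binS bin1. Qed.

(** At r = n + 1 the coefficient in degree 2 is 0 + C(n + 1 - m, 2) - C(n + 1, 2), which is at most
    -n. *)
Lemma positive_leq n m r : (0 < m)%N -> (m <= n)%N -> positive n m r -> (r <= n)%N.
Proof.
move=> m0 mn h; rewrite leqNgt; apply/negP => /positive_le/(_ h)/positiveP/(_ 2%N).
rewrite /power_coef ltnn ltnNge mn /= !alt_bin_even // subSnn.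
have : ('C(n.+1 - m, 2) <= 'C(n, 2))%N by apply: leq_bin2l; lia.
by rewrite (bin2E n) (_ : 'C(1, 2) = 0%N) //; lia.
Qed.

(** For m < n and r = m + 1 the coefficient in degree 2 is C(n - m, 2) + 0 - C(m + 1, 2). Since n -
    m <= m, it is at most -m. *)
Lemma positive_leq_uphalf n m r : (0 < n)%N -> (uphalf n <= m)%N -> (m <= n)%N ->
  positive n m r -> (r <= m)%N.
Proof.
move=> n0 nm mn h; move: mn; rewrite leq_eqVlt => /predU1P[e|mn].
  by rewrite e in nm h *; apply: positive_leq h.
rewrite leqNgt; apply/negP => /positive_le/(_ h)/positiveP/(_ 2%N).
rewrite /power_coef mn ltnn !alt_bin_even // subSnn /poly_dim.
have : ('C((n - m.+1 + 2).-1, 2) <= 'C(m, 2))%N by apply: leq_bin2l; lia.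
by rewrite (bin2E m) (_ : 'C(1, 2) = 0%N) //; lia.
Qed.

(** For even n the two halves agree and the previous bound applies. For n = 2m + 1 and r = m + 2 the
    coefficient in degree 2 is C(m, 2) + 1 - C(m + 2, 2) = -2m, which is negative because n >= 2. *)
Lemma positive_leq_half n r : (2 <= n)%N -> positive n n./2 r -> (r <= uphalf n)%N.
Proof.
move=> n2 h; have [en|on] := boolP (odd n); last first.
  rewrite uphalf_half (negPf on) add0n.
  by apply: positive_leq_uphalf h; lia.
rewrite leqNgt; apply/negP => /positive_le/(_ h)/positiveP/(_ 2%N).
set m := n./2; have en' : n = m.*2.+1 by rewrite /m; lia.
have -> : uphalf n = m.+1 by lia.
rewrite /power_coef (_ : (m.+2 <= m)%N = false); last lia.
rewrite (_ : (m.+2 <= n)%N); last lia.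
rewrite !alt_bin_even // /poly_dim (_ : (m.+2 - m = 2)%N); last lia.
rewrite (_ : ((n - m.+2 + 2).-1 = m)%N); last lia.
by rewrite (bin2E m.+1) (bin2E m) (_ : 'C(2, 2) = 1%N) //; lia.
Qed.

(** In even positive degrees the contributions are C(r - m', d) <= C(r - m, d). In odd degrees this
    comparison is reversed, hence the passage through [positive_half]. At m' = r the contribution is
    the series 1, which vanishes in positive degree. *)
Lemma positive_decrease n m m' r : (m <= m')%N -> (m' <= r)%N -> (r <= n)%N ->
  positive n m' r -> positive n m r.
Proof.
move=> mm' m'r rn /positiveP h; apply: positive_half => // d od d0.
apply: le_trans (h d) _; rewrite lerD2r lerD2l /power_coef.
move: m'r; rewrite leq_eqVlt => /predU1P[e|m'r].
  rewrite e leqnn subnn poly_dim0 (gtn_eqF d0).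
  by case: leqP => // _; rewrite alt_bin_even.
have mr := leq_ltn_trans mm' m'r.
rewrite (leqNgt r m') m'r (leqNgt r m) mr /= !alt_bin_even //.
by rewrite lez_nat leq_bin2l //; lia.
Qed.

(** Here r lies below both m and m', so both contributions are of the form [poly_dim] and grow with
    the exponent in every degree. *)
Lemma positive_increase n m m' r : (r <= m)%N -> (m <= m')%N ->
  positive n m r -> positive n m' r.
Proof.
move=> rm mm' /positiveP h; apply/positiveP => d; apply: le_trans (h d) _.
rewrite lerD2r lerD2l /power_coef rm (leq_trans rm mm') poly_dim_leq //; lia.
Qed.

(* In an even degree d with n + d > 2r the coefficient is nonnegative for every
   m; otherwise the contributions of m and m' compare directly. *)
Lemma positive_swap n m m' r : (m <= r)%N -> (r <= m')%N -> (r <= n)%N ->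
  (m + m' <= n.+1)%N -> positive n m' r -> positive n m r.
Proof.
move=> mr rm' rn le /positiveP h; apply: positive_half => // d od d0.
have [big|small] := leqP r (n - r + d.-1).
  rewrite addrAC addr_ge0 ?power_coef_even_ge0 //.
  by rewrite /power_coef rn alt_bin_even // subr_ge0 poly_dim_ge_bin.
apply: le_trans (h d) _; rewrite lerD2r lerD2l /power_coef rm'.
have -> : (if (r <= m)%N then poly_dim (m - r) d else alt_bin (r - m) d) =
  'C(r - m, d)%:Z.
  case: leqP => rm; last by rewrite alt_bin_even.
  have -> : r = m by apply/eqP; rewrite eqn_leq rm mr.
  by rewrite subnn poly_dim0 (gtn_eqF d0) bin_small.
(* The needed inequality m' - r + d - 1 <= r - m follows from n + d <= 2r and m + m' <= n + 1. *)
by rewrite lez_nat leq_bin2l //; lia.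
Qed.

(** Let c be the coefficient of (1 - t)^-(q+1) in degree D. Multiplying its tail from degree D + 1
    by 1 - t gives the tail of (1 - t)^-q from the same degree plus c t^(D+1). So each exponent of
    the previous list is raised by one, and c copies of the exponent 1 are added. *)
Lemma poly_dim_tail q D : exists2 l : seq nat, {in l, forall e, (e <= q)%N} &
  forall d, (if (D <= d)%N then poly_dim q d else 0) =
    \sum_(e <- l) shift D (poly_dim e) d.
Proof.
elim: q D => [|q IH] [|D].
- by exists [:: 0%N] => [e|d]; rewrite ?inE ?big_seq1 ?/shift ?subn0 // => /eqP ->.
- by exists [::] => // -[|d]; rewrite big_nil // poly_dim0 if_same.
- by exists [:: q.+1] => [e|d]; rewrite ?inE ?big_seq1 ?/shift ?subn0 // => /eqP ->.
have [l lq hl] := IH D.+1.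
exists (map succn l ++ nseq `|poly_dim q.+1 D|%N 1%N).
  by move=> e; rewrite mem_cat => /orP[/mapP[e' /lq le ->] //|/nseqP[-> _]].
apply: diff_inj => d; rewrite diff_sum big_cat big_map /= big_nseq.
rewrite (eq_bigr (fun e => shift D.+1 (poly_dim e) d)) => [|e _]; last first.
  by rewrite diff_shift; apply: eq_shift; exact: diff_poly_dim.
rewrite -hl iter_addr_0 diff_shift (eq_shift _ (diff_poly_dim 0)).
have -> : shift D.+1 (poly_dim 0) d *+ `|poly_dim q.+1 D|%N =
  poly_dim q.+1 D * (d == D.+1)%:R.
  rewrite -[LHS]mulr_natl natz gez0_abs // /shift.
  case: (ltngtP D.+1 d) => [lt|_|<-]; rewrite ?mulr0 ?mulr1 //;
    last by rewrite subnn poly_dim0 mulr1.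
  by rewrite poly_dim0 subn_eq0 leqNgt lt mulr0.
rewrite /diff; case: d => [|d]; first by rewrite mulr0.
have := diff_poly_dim q d.+1; rewrite /diff => <-.
rewrite eqSS !ltnS; case: (ltngtP D d) => [lt|gt|->];
  rewrite ?mulr0 ?mulr1 ?addr0 ?subr0 //.
by rewrite subrK.
Qed.

(** In degrees above r the alternating terms vanish, and (1 - t)^r H is a sum of two tails as in
    [poly_dim_tail]. In degrees j <= r it is a finite sum of monomials t^j, with multiplicities that
    are nonnegative by hypothesis. Dividing by (1 - t)^r adds r to every exponent. *)
Lemma positive_decomposition n m r : (r <= n)%N -> (m <= n)%N -> positive n m r ->
  exists2 l : seq (nat * nat), {in l, forall x, (r <= x.2 <= n)%N} &
  forall d, edge_dim n m d = \sum_(x <- l) shift x.1 (poly_dim x.2) d.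
Proof.
move=> rn mn pos; pose A := iter r diff (edge_dim n m).
have tail d : (r < d)%N -> A d = poly_dim (n - r) d + poly_dim (m - r) d.
  move=> lt; rewrite /A iter_diff_edge_dim /power_coef rn.
  have alt0 s : (s < d)%N -> alt_bin s d = 0 by move=> sd;
    rewrite /alt_bin bin_small ?mulr0.
  rewrite (alt0 r lt) subr0; case: leqP => // /ltnW mr.
  (* For m < r the truncated difference m - r is 0, and the series 1 vanishes in degree d > r. *)
  rewrite (eqP (_ : m - r == 0)%N) // poly_dim0 alt0 ?(gtn_eqF (leq_ltn_trans _ lt)) //.
  exact: leq_ltn_trans (leq_subr _ _) lt.
have [l1 l1n h1] := poly_dim_tail (n - r) r.+1.
have [l2 l2m h2] := poly_dim_tail (m - r) r.+1.
pose l0 := flatten [seq nseq `|A j|%N (j, 0%N) | j <- index_iota 0 r.+1].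
pose l := l0 ++ [seq (r.+1, e) | e <- l1 ++ l2].
have hl d : A d = \sum_(x <- l) shift x.1 (poly_dim x.2) d.
  rewrite big_cat big_map big_cat /= -h1 -h2 big_flatten big_map /=.
  have -> : \sum_(j <- index_iota 0 r.+1)
      \sum_(x <- nseq `|A j|%N (j, 0%N)) shift x.1 (poly_dim x.2) d
      = if (r < d)%N then 0 else A d.
    rewrite (eq_bigr (fun j => if j == d then A d else 0)) => [|j _].
      case: ltnP => lt.
        by rewrite big1_seq // => j; rewrite mem_index_iota; case: eqP => // -> /=; lia.
      rewrite (bigD1_seq d) ?iota_uniq ?mem_index_iota //= eqxx big1 ?addr0 // => j.
      by move=> /negPf ->.
    rewrite big_nseq iter_addr_0 /= -[LHS]mulr_natl natz gez0_abs ?pos // /shift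
      poly_dim0 subn_eq0 eq_sym.
    by case: (ltngtP j d) => [lt|lt|->]; rewrite ?mulr0 ?mulr1 ?subnn ?poly_dim0 ?mulr1
      ?subn_eq0 ?mulr0.
  by case: ltnP => [/tail ->|_]; rewrite ?add0r ?addr0.
exists [seq (x.1, (r + x.2)%N) | x <- l].
  move=> _ /mapP[[s e] xl ->] /=; rewrite leq_addr /=.
  move: xl; rewrite mem_cat => /orP[/flatten_mapP[j _ /nseqP[[_ ->] _]]|];
    first by rewrite addn0.
  move=> /mapP[e' + [_ ->]]; rewrite mem_cat => /orP[/l1n|/l2m]; lia.
apply: (@iter_diff_inj r) => d; rewrite -/A hl iter_diff_sum big_map.
by apply: eq_bigr => x _; rewrite iter_diff_shift; apply: eq_shift => e;
  rewrite iter_diff_poly_dim.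
Qed.

End PowerSeries.

(** * Graded modules *)

Section FiniteDimension.
Variables (K : fieldType) (k : nat) (M : gradedModule K k).
Implicit Types (A : set M).

(** The two transition matrices multiply to the identity, and ranks are compared. Matrices over K
    replace vector spaces here because K acts on M only through constant polynomials. *)
Lemma basis_size_le A r r' (b : 'I_r -> M) (b' : 'I_r' -> M) :
  is_basis A b -> is_basis A b' -> (r <= r')%N.
Proof.
move=> [Ab ib sb] [Ab' ib' sb'].
have /choice[C hC] i : exists c : 'I_r' -> K, b i = \sum_j (c j)%:MP *: b' j
  by apply/sb'.
have /choice[D hD] i : exists c : 'I_r -> K, b' i = \sum_j (c j)%:MP *: b j by apply/sb.
apply: (@mulmx1_min K r r' (\matrix_(i, j) C i j) (\matrix_(i, j) D i j)).
apply/matrixP=> i j; rewrite !mxE; apply/eqP; rewrite -subr_eq0; apply/eqP.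
pose c j : K := \sum_l C i l * D l j - (i == j)%:R.
have c0 : \sum_j (c j)%:MP *: b j = 0.
  under eq_bigr do rewrite rmorphB rmorph_sum scalerBl scaler_suml.
  rewrite sumrB exchange_big /= [X in _ - X](bigD1 i) //= eqxx mpolyC1 scale1r.
  rewrite [X in _ - (_ + X)]big1 ?addr0 => [|l /negPf li];
    last by rewrite eq_sym li mpolyC0 scale0r.
  apply/eqP; rewrite subr_eq0 eq_sym; apply/eqP.
  rewrite {1}[b i]hC; apply: eq_bigr => l _; rewrite {1}[b' l]hD scaler_sumr.
  by apply: eq_bigr => j' _; rewrite scalerA rmorphM.
by rewrite -[RHS](ib _ c0 j) /c; congr (_ - _); apply: eq_bigr => l _; rewrite !mxE.
Qed.

Lemma basis_size_uniq A r r' (b : 'I_r -> M) (b' : 'I_r' -> M) :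
  is_basis A b -> is_basis A b' -> r = r'.
Proof. move=> h h'; apply/eqP.
by rewrite eqn_leq (basis_size_le h h') (basis_size_le h' h). Qed.

Lemma exists_basis A n (g : 'I_n -> M) :
  (forall i, A (g i)) ->
  (forall v, A v -> exists c : 'I_n -> K, v = \sum_i (c i)%:MP *: g i) ->
  exists r (b : 'I_r -> M), is_basis A b.
Proof.
elim: n g => [|n IH] g Ag sg; first by exists 0%N, g; split=> // c _ [].
have [ig|/existsNP[c /not_implyP[c0 /existsNP[j /eqP cj]]]] := pselect
  (forall c : 'I_n.+1 -> K, \sum_i (c i)%:MP *: g i = 0 -> forall i, c i = 0).
  by exists n.+1, g.
apply: (IH (fun i => g (lift j i))) => [i|v /sg[d ->]]; first exact: Ag.
exists (fun i => d (lift j i) - d j / c j * c (lift j i)).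
have /(congr1 (fun v => (d j / c j)%:MP *: v)) := c0.
rewrite scaler0 scaler_sumr => /(congr1 (fun v => \sum_i (d i)%:MP *: g i - v)).
rewrite subr0 => <-; rewrite -sumrB (bigD1_ord j) //= scalerA -rmorphM divfK // subrr
  add0r.
by apply: eq_bigr => i _; rewrite scalerA -scalerBl -rmorphM rmorphB.
Qed.

End FiniteDimension.

(** * Projections onto graded pieces, and finite dimension of the pieces *)

Section HomogeneousComponents.
Variables (K : fieldType) (k : nat) (N : gradedModule K k).
Local Notation piece := (@gm_piece K k N).

Lemma gm_pieceC c d v : piece d v -> piece d (c%:MP *: v).
Proof. move=> h; rewrite -[d]add0r -alg_mpolyC; apply: gm_pieceZ => //.
by apply: dhomogZ; exact: dhomog1. Qed.

Lemma gm_pieceN d v : piece d v -> piece d (- v).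
Proof. by move=> /(gm_pieceC (-1)); rewrite rmorphN rmorph1 scaleN1r. Qed.

Lemma gm_piece_sum (I : Type) (r : seq I) (Q : pred I) (f : I -> N) d :
  (forall i, Q i -> piece d (f i)) -> piece d (\sum_(i <- r | Q i) f i).
Proof.
by move=> h; elim/big_rec: _ => [|i v Qi]; [exact: gm_piece0|exact/gm_pieceD/h].
Qed.

Definition decomposition (v : N) (c : int -> N) : Prop :=
  (forall d, piece d (c d)) /\
  exists s, [/\ uniq s, (forall d, d \notin s -> c d = 0) & v = \sum_(d <- s) c d].

Lemma sum_decomposition_widen (s s' : seq int) (c : int -> N) :
  uniq s -> uniq s' -> {subset s <= s'} -> (forall d, d \notin s -> c d = 0) ->
  \sum_(d <- s) c d = \sum_(d <- s') c d.
Proof.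
move=> us us' ss c0; rewrite [RHS](bigID (mem s)) /= [X in _ + X]big1 ?addr0 //.
rewrite -[RHS]big_filter; apply: perm_big; apply: uniq_perm => // [|d].
  exact: filter_uniq.
by rewrite mem_filter /=; case: (boolP (d \in s)) => // /ss ->.
Qed.

Lemma decomposition_exists v : exists c, decomposition v c.
Proof.
have [s [u [hu ->]]] := gm_sum v.
(* The list supplied by [gm_sum] may repeat a degree; collecting equal degrees multiplies [u d] by
   its multiplicity. *)
exists (fun d => u d *+ count_mem d s); split=> [d|].
  elim: (count_mem d s) => [|n IH]; first exact: gm_piece0.
  by rewrite mulrS; apply: gm_pieceD.
exists (undup s); split=> [|d|]; first exact: undup_uniq.
  by rewrite mem_undup => /count_memPn ->.
rewrite -big_undup_iterop_count; apply: eq_bigr => d _.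
by rewrite Monoid.iteropE; elim: (count_mem d s) => //= n ->; rewrite mulrS.
Qed.

Lemma decompositionB v v' c c' : decomposition v c -> decomposition v' c' ->
  decomposition (v - v') (fun d => c d - c' d).
Proof.
move=> [hc [s [us c0 ->]]] [hc' [s' [us' c0' ->]]]; split=> [d|].
  by apply: gm_pieceD => //; exact: gm_pieceN.
exists (undup (s ++ s')); split=> [|d|]; first exact: undup_uniq.
  by rewrite mem_undup mem_cat negb_or => /andP[/c0 -> /c0' ->]; rewrite subrr.
rewrite sumrB; congr (_ - _).
  apply: sum_decomposition_widen; rewrite ?undup_uniq // => d.
  by rewrite mem_undup mem_cat => ->.
apply: sum_decomposition_widen; rewrite ?undup_uniq // => d.
by rewrite mem_undup mem_cat orbC => ->.
Qed.

Lemma decomposition_uniq v c c' : decomposition v c -> decomposition v c' -> c = c'.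
Proof.
move=> /decompositionB h /h{h}[hc [s [us c0 e]]]; apply/funext => d.
apply/subr0_eq; have [ds|/c0 //] := boolP (d \in s).
by apply: (gm_direct us hc _ ds); rewrite -e subrr.
Qed.

Definition gcomp (d : int) (v : N) : N := sval (cid (decomposition_exists v)) d.

Lemma gcompP v : decomposition v (gcomp^~ v).
Proof. exact: (svalP (cid (decomposition_exists v))). Qed.

Lemma gcomp_piece v d : piece d (gcomp d v).
Proof. exact: (gcompP v).1. Qed.

Lemma gcompE v c : decomposition v c -> gcomp^~ v = c.
Proof. exact/decomposition_uniq/gcompP. Qed.

Lemma gcompB d v v' : gcomp d (v - v') = gcomp d v - gcomp d v'.
Proof. exact: (congr1 (@^~ d) (gcompE (decompositionB (gcompP v) (gcompP v')))). Qed.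

HB.instance Definition _ d :=
  GRing.isZmodMorphism.Build N N (gcomp d) (gcompB d).

Lemma gcomp_homog d v : piece d v -> gcomp d v = v.
Proof.
move=> hv; suff /gcompE/(congr1 (@^~ d)) -> : decomposition v (fun e =>
  if e == d then v else 0).
  by rewrite eqxx.
split=> [e|]; first by case: eqP => [->|_]; [exact: hv|exact: gm_piece0].
exists [:: d]; split=> // [e|]; last by rewrite big_seq1 eqxx.
by rewrite inE => /negPf ->.
Qed.

Lemma gcompZ (e : nat) (p : {mpoly K[k]}) v d :
  p \is e.-homog -> gcomp (e%:Z + d) (p *: v) = p *: gcomp d v.
Proof.
move=> hp; have [hc [s [us c0 ev]]] := gcompP v.
suff /gcompE/(congr1 (@^~ (e%:Z + d))) -> :
    decomposition (p *: v) (fun d => p *: gcomp (d - e%:Z) v).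
  by rewrite addrC addKr.
split=> [f|]; first by rewrite -{1}[f](subrK e%:Z) addrC; exact: gm_pieceZ.
exists [seq d + e%:Z | d <- s]; split=> [|f hf|].
- by rewrite map_inj_uniq //; exact: addIr.
- rewrite c0 ?scaler0 //; apply: contra hf => hf; apply/mapP.
  by exists (f - e%:Z); rewrite ?subrK.
- by rewrite {1}ev scaler_sumr big_map; apply: eq_bigr => f _; rewrite addrK.
Qed.

Lemma gcomp_eq0 v : exists D : nat, forall d, (D%:Z <= `|d|) -> gcomp d v = 0.
Proof.
have [_ [s [_ c0 _]]] := gcompP v; exists (\max_(d <- s) `|d|.+1)%N => d le.
apply: c0; apply: contraL le => ds; rewrite -ltNge -abszE ltz_nat.
exact: (@leq_bigmax_seq _ _ xpredT (fun d : int => `|d|.+1%N)).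
Qed.

Lemma gcomp_scale d (p : {mpoly K[k]}) v : gcomp d (p *: v) =
  \sum_(m <- msupp p) (p@_m)%:MP *: ('X_[m] *: gcomp (d - (mdeg m)%:Z) v).
Proof.
rewrite {1}[p]mpolyE scaler_suml (raddf_sum (gcomp d)); apply: eq_bigr => m _ /=.
have hom : (p@_m *: 'X_[m] : {mpoly K[k]}) \is (mdeg m).-homog by apply: dhomogZ;
  rewrite dhomogX.
have -> : gcomp d = gcomp ((mdeg m)%:Z + (d - (mdeg m)%:Z)) by rewrite addrC subrK.
by rewrite /= gcompZ // scalerA mul_mpolyC.
Qed.

(** The given generators need not be homogeneous. The piece of degree d is spanned by monomials
    times homogeneous components of generators, and each generator has finitely many of these, so
    monomials of large degree contribute nothing. *)
Lemma piece_spanned : finitely_generated N -> forall d, exists n (g : 'I_n -> N),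
  (forall i, piece d (g i)) /\
  forall v, piece d v -> exists c : 'I_n -> K, v = \sum_i (c i)%:MP *: g i.
Proof.
move=> [gs fg] d.
have /choice[B hB] (i : 'I_(size gs)) : exists D : nat, forall d,
  (D%:Z <= `|d|) -> gcomp d gs`_i = 0 by exact: gcomp_eq0.
(* If deg m >= D, then |d - deg m| exceeds every bound [B i], so the component of the generator in
   degree d - deg m is zero. *)
pose D := (\max_i B i + `|d|.+1)%N.
pose I := ('I_(size gs) * 'X_{1..k < D})%type.
pose g (x : I) : N := 'X_[x.2] *: gcomp (d - (mdeg x.2)%:Z) gs`_x.1.
exists #|predT : pred I|, (g \o enum_val); split=> [i|v hv].
  rewrite /g /= -[X in piece X](subrK (mdeg (enum_val i).2)%:Z) addrC.
  by apply: gm_pieceZ; [rewrite dhomogX|exact: gcomp_piece].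
have [c ec] := fg v; pose coef (x : I) := (c x.1)@_(x.2).
exists (coef \o enum_val).
rewrite -(gcomp_homog hv) {1}ec (raddf_sum (gcomp d)) /=.
rewrite -(big_enum_val (A := predT) (fun x => (coef x)%:MP *: g x)) /=.
rewrite -(pair_bigA _ (fun i m => (coef (i, m))%:MP *: g (i, m))) /=.
apply: eq_bigr => i _; rewrite gcomp_scale.
pose F (m : 'X_{1..k}) := ((c i)@_m)%:MP *: ('X_[m] *: gcomp (d - (mdeg m)%:Z) gs`_i).
rewrite -/(F _).
have F0 m : (D <= mdeg m)%N -> F m = 0.
  move=> le; rewrite /F hB ?scaler0 //.
  have le1 : (B i <= \max_i B i)%N by exact: leq_bigmax.
  by move: le le1; rewrite /D; lia.
rewrite (bigID (fun m => mdeg m < D)%N) /= [X in _ + X]big1 ?addr0; last first.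
  by move=> m; rewrite -leqNgt => /F0.
rewrite (big_mksub_cond 'X_{1..k < D}) ?msupp_uniq //= big_rmcond // => m.
by rewrite bmdeg /F /= => /memN_msupp_eq0 ->; rewrite scale0r.
Qed.

Lemma hilbert_series_basis : finitely_generated N -> forall d,
  exists b : 'I_(hilbert_series N d) -> N, is_basis (piece d) b.
Proof.
move=> fg d; have [n [g [hg sg]]] := piece_spanned fg d.
have [r rb] := exists_basis hg sg.
by rewrite /hilbert_series; case: xgetP => // h; case: (h r).
Qed.

Lemma hilbert_seriesE d r (b : 'I_r -> N) :
  is_basis (piece d) b -> hilbert_series N d = r.
Proof.
move=> hb; rewrite /hilbert_series; case: xgetP => [r' -> [b' hb']|/(_ r) []].
  exact: basis_size_uniq hb' hb.
by exists b.
Qed.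

End HomogeneousComponents.

(** * Generic linear forms form a regular sequence *)

Section Exchange.
Variables (R : comNzRingType) (E : lmodType R) (P : set E).
Variables (a : nat -> R) (F : nat -> {linear E -> E}) (r : nat).

(** The submodule generated inside [P] by the new forms and by what is left of the original
    sequence; congruence modulo it replaces the quotient. The forms are operators and not scalars
    because their parameters do not belong to [R]. *)
Definition mixed_span (s i : nat) (v : E) : Prop :=
  exists w z : nat -> E, [/\ forall u, P (w u), forall j, P (z j) &
    v = \sum_(u < s) F u (w u) + \sum_(j < i) a j *: z j].

Hypothesis P0 : P 0.
Hypothesis PB : forall u v, P u -> P v -> P (u - v).
Hypothesis PZ : forall c v, P v -> P (c *: v).
Hypothesis PF : forall u v, P v -> P (F u v).
Hypothesis FC : forall u s v, F u (F s v) = F s (F u v).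

Lemma mixed_span0 s i : mixed_span s i 0.
Proof.
exists (fun _ => 0), (fun _ => 0); split=> //.
by rewrite !big1 ?addr0 // => j _; rewrite ?raddf0 ?scaler0.
Qed.

Lemma mixed_spanB s i u v :
  mixed_span s i u -> mixed_span s i v -> mixed_span s i (u - v).
Proof.
move=> [w [z [Pw Pz ->]]] [w' [z' [Pw' Pz' ->]]].
exists (fun u => w u - w' u), (fun j => z j - z' j); split=> [?|?|]; try exact: PB.
rewrite [X in _ = X + _](eq_bigr (fun u : 'I_s => F u (w u) - F u (w' u))) => [|j _];
  last by rewrite /= linearB.
rewrite [X in _ = _ + X](eq_bigr (fun j : 'I_i => a j *: z j - a j *: z' j)) => [|j _];
  last by rewrite /= scalerBr.
by rewrite !sumrB addrACA -opprD.
Qed.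

Lemma mixed_spanN s i v : mixed_span s i v -> mixed_span s i (- v).
Proof. by rewrite -sub0r; apply: mixed_spanB; exact: mixed_span0. Qed.

Lemma mixed_spanD s i u v :
  mixed_span s i u -> mixed_span s i v -> mixed_span s i (u + v).
Proof. by move=> hu hv; rewrite -[v]opprK; apply/mixed_spanB/mixed_spanN. Qed.

Lemma mixed_span_sum s i (I : Type) (rI : seq I) (Q : pred I) (f : I -> E) :
  (forall j, Q j -> mixed_span s i (f j)) -> mixed_span s i (\sum_(j <- rI | Q j) f j).
Proof.
by move=> h; elim/big_rec: _ => [|j v Qj hv];
  [exact: mixed_span0|exact/mixed_spanD/hv/h].
Qed.

(** Commutation is required only with [F u] for u < s: slicing and contracting in t_s commute with
    the earlier forms but not with [F s] itself. *)
Lemma mixed_span_lin (G : {linear E -> E}) s i v :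
  (forall v, P v -> P (G v)) -> (forall u v, (u < s)%N -> G (F u v) = F u (G v)) ->
  mixed_span s i v -> mixed_span s i (G v).
Proof.
move=> PG GC [w [z [Pw Pz ->]]].
exists (fun u => G (w u)), (fun j => G (z j)); split=> [?|?|]; try exact: PG.
rewrite raddfD !raddf_sum /=; congr (_ + _).
  by apply: eq_bigr => u _; rewrite GC.
by apply: eq_bigr => j _; rewrite linearZ.
Qed.

Lemma mixed_spanZ s i c v : mixed_span s i v -> mixed_span s i (c *: v).
Proof.
move=> [w [z [Pw Pz ->]]].
exists (fun u => c *: w u), (fun j => c *: z j); split=> [?|?|]; try exact: PZ.
rewrite scalerDr !scaler_sumr; congr (_ + _).
  by apply: eq_bigr => u _; rewrite linearZ.
by apply: eq_bigr => j _; rewrite !scalerA mulrC.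
Qed.

Lemma mixed_spanF u s i v : mixed_span s i v -> mixed_span s i (F u v).
Proof. by apply: mixed_span_lin => [?|? ? _]; [exact: PF|exact: FC]. Qed.

Lemma mixed_spanSl s i v :
  mixed_span s.+1 i v <-> exists2 w, P w & mixed_span s i (v - F s w).
Proof.
split=> [[w [z [Pw Pz ->]]]|[w0 Pw0 [w [z [Pw Pz e]]]]].
  exists (w s) => //; exists w, z; split=> //.
  by rewrite big_ord_recr /= addrAC addrK.
exists (fun u => if u == s then w0 else w u), z; split=> // [u|]; first by case: ifP.
rewrite big_ord_recr /= eqxx (eq_bigr (fun u : 'I_s => F u (w u))).
  by rewrite addrAC -e subrK.
by move=> u _; rewrite ltn_eqF.
Qed.

Lemma mixed_spanSr s i v :
  mixed_span s i.+1 v <-> exists2 z, P z & mixed_span s i (v - a i *: z).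
Proof.
split=> [[w [z [Pw Pz ->]]]|[z0 Pz0 [w [z [Pw Pz e]]]]].
  exists (z i) => //; exists w, z; split=> //.
  by rewrite big_ord_recr /= addrA addrK.
exists w, (fun u => if u == i then z0 else z u); split=> // [u|]; first by case: ifP.
rewrite big_ord_recr /= eqxx (eq_bigr (fun u : 'I_i => a u *: z u)).
  by rewrite addrA -e subrK.
by move=> u _; rewrite ltn_eqF.
Qed.

Hypothesis a_regular : forall i v, (i < r)%N -> P v ->
  mixed_span 0 i (a i *: v) -> mixed_span 0 i v.
Hypothesis F_regular : forall s i, (s + i < r)%N ->
  (forall v, P v -> mixed_span s i (a i *: v) -> mixed_span s i v) ->
  forall v, P v -> mixed_span s i (F s v) -> mixed_span s i v.

(* If F s is regular modulo the span before and after adjoining a i, then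
   a i remains regular after adjoining F s. *)
Lemma exchange_regular s i v : (s + i < r)%N -> P v ->
  mixed_span s i (a i *: v) -> mixed_span s i v.
Proof.
elim: s i v => [|s IH] i v ltr Pv; first exact: a_regular.
have lt1 : (s + i.+1 < r)%N by rewrite addnS.
have lt0 : (s + i < r)%N by apply: ltn_trans lt1; rewrite addnS.
move=> /mixed_spanSl[w Pw e].
(* [F s w] is congruent to [a i *: v], so it lies in the span enlarged by [a i]. The next element
   [a i.+1] is still regular there by induction, which makes [F s] regular and puts w in that span.
   The condition s + i < r counts the elements that are left. *)
have /mixed_spanSr[z Pz wz] : mixed_span s i.+1 w.
  apply: (F_regular lt1) => // [x Px|]; first by apply: IH => //.
  apply/mixed_spanSr; exists v => //.
  by rewrite -[X in mixed_span s i X]opprB; apply: mixed_spanN.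
apply/mixed_spanSl; exists z => //.
apply: IH => //; first exact/PB/PF.
have -> : a i *: (v - F s z) = (a i *: v - F s w) + F s (w - a i *: z).
  by rewrite (raddfB (F s)) /= linearZ_LR addrA subrK scalerBr.
by apply: mixed_spanD => //; apply: mixed_spanF.
Qed.

(** This is the case i = 0 of the exchange: [a 0] is still regular after s exchanges, and one
    regular element suffices for [F s]. *)
Lemma F_regular_seq s v :
  (s < r)%N -> P v -> mixed_span s 0 (F s v) -> mixed_span s 0 v.
Proof.
move=> ltr Pv; apply: F_regular => // [|w Pw]; rewrite ?addn0 //.
by apply: exchange_regular; rewrite ?addn0.
Qed.

End Exchange.

Section PolynomialsOverModule.
Variables (R : pzRingType) (M : lmodType R) (p : nat).
Implicit Types (g : 'X_{1..p} -> M) (m mu : 'X_{1..p}).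

(** Cuts M[t_1, ..., t_p] out of all functions from exponents to M, whose pointwise module structure
    is already available. *)
Definition fin_supp g : Prop := exists D, forall mu, (D <= mdeg mu)%N -> g mu = 0.

Definition mshift m g : 'X_{1..p} -> M :=
  fun mu => if (m <= mu)%MM then g (mu - m)%MM else 0.

(** Left inverse of multiplication by t^m ([mshift]), discarding the terms that t^m does not
    divide. *)
Definition mcontract m g : 'X_{1..p} -> M := fun mu => g (mu + m)%MM.

Definition mslice (o : 'I_p) (j : nat) g : 'X_{1..p} -> M :=
  fun mu => if mu o == j then g mu else 0.

Lemma mshift_linear m : linear (mshift m).
Proof.
by move=> c u v; apply/funext=> mu; rewrite /mshift; case: ifP => //; rewrite !fctE;
   case: ifP => // _ _; rewrite scaler0 addr0.
Qed.
HB.instance Definition _ m := GRing.isLinear.Build R _ _ _ (mshift m) (mshift_linear m).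

Lemma mcontract_linear m : linear (mcontract m).
Proof. by []. Qed.
HB.instance Definition _ m :=
  GRing.isLinear.Build R _ _ _ (mcontract m) (mcontract_linear m).

Lemma mslice_linear o j : linear (mslice o j).
Proof.
by move=> c u v; apply/funext=> mu; rewrite /mslice; case: ifP => //; rewrite !fctE;
   case: ifP => // _ _; rewrite scaler0 addr0.
Qed.
HB.instance Definition _ o j :=
  GRing.isLinear.Build R _ _ _ (mslice o j) (mslice_linear o j).

Lemma mshiftZ c m g : mshift m (c *: g) = c *: mshift m g.
Proof. exact: linearZ_LR. Qed.

Lemma mcontractZ c m g : mcontract m (c *: g) = c *: mcontract m g.
Proof. exact: linearZ_LR. Qed.

Lemma msliceZ c o j g : mslice o j (c *: g) = c *: mslice o j g.
Proof. exact: linearZ_LR. Qed.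

Lemma fin_supp0 : fin_supp 0. Proof. by exists 0%N. Qed.

Lemma fin_suppB g g' : fin_supp g -> fin_supp g' -> fin_supp (g - g').
Proof.
move=> [D hD] [D' hD']; exists (maxn D D') => mu; rewrite geq_max => /andP[h h'].
by rewrite !fctE hD ?hD' ?subr0.
Qed.

Lemma fin_suppD g g' : fin_supp g -> fin_supp g' -> fin_supp (g + g').
Proof.
move=> hg /(fin_suppB fin_supp0) /(fin_suppB hg).
by rewrite sub0r opprK.
Qed.

Lemma fin_suppZ c g : fin_supp g -> fin_supp (c *: g).
Proof. by move=> [D hD]; exists D => mu /hD e; rewrite !fctE e scaler0. Qed.

Lemma fin_supp_sum (I : Type) (r : seq I) (Q : pred I) (f : I -> 'X_{1..p} -> M) :
  (forall i, Q i -> fin_supp (f i)) -> fin_supp (\sum_(i <- r | Q i) f i).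
Proof.
by move=> h; elim/big_rec: _ => [|i g Qi]; [exact: fin_supp0|exact/fin_suppD/h].
Qed.

Lemma fin_supp_mshift m g : fin_supp g -> fin_supp (mshift m g).
Proof.
move=> [D hD]; exists (D + mdeg m)%N => mu le; rewrite /mshift; case: ifP => // lm.
by apply: hD; rewrite -(leq_add2r (mdeg m)) -mdegD submK.
Qed.

Lemma fin_supp_mcontract m g : fin_supp g -> fin_supp (mcontract m g).
Proof.
by move=> [D hD]; exists D => mu le; apply: hD; rewrite mdegD (leq_trans le) ?leq_addr.
Qed.

Lemma fin_supp_mslice o j g : fin_supp g -> fin_supp (mslice o j g).
Proof. by move=> [D hD]; exists D => mu /hD h; rewrite /mslice h if_same. Qed.

Lemma mshiftD m m' g : mshift m (mshift m' g) = mshift (m + m')%MM g.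
Proof.
apply/funext=> mu; rewrite /mshift submDA.
have [/mnm_lepP le|/negP nle] := boolP (m <= mu)%MM.
  have -> // : (m' <= mu - m)%MM = (m + m' <= mu)%MM.
  apply/mnm_lepP/mnm_lepP => h i; move: (h i) (le i); rewrite !mnmDE !mnmBE; lia.
case: ifP => // /mnm_lepP h; case: nle; apply/mnm_lepP => i; move: (h i).
by rewrite mnmDE; lia.
Qed.

Lemma mshiftC m m' g : mshift m (mshift m' g) = mshift m' (mshift m g).
Proof. by rewrite !mshiftD addmC. Qed.

Lemma mshiftK m g : mcontract m (mshift m g) = g.
Proof. by apply/funext=> mu; rewrite /mcontract /mshift lem_addl addmK. Qed.

Lemma mnm1Mn_ne (o o' : 'I_p) l : o != o' -> (U_(o') *+ l)%MM o = 0%N.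
Proof. by move=> h; rewrite mulmnE mnm1E eq_sym (negPf h). Qed.

Lemma mcontract_mshift (o o' : 'I_p) l l' g : o != o' ->
  mcontract (U_(o) *+ l)%MM (mshift (U_(o') *+ l')%MM g) =
  mshift (U_(o') *+ l')%MM (mcontract (U_(o) *+ l)%MM g).
Proof.
move=> ne; apply/funext=> mu; rewrite /mcontract /mshift.
have h i : (U_(o) *+ l)%MM i = 0%N \/ (U_(o') *+ l')%MM i = 0%N.
  by have [->|nei] := eqVneq i o; [right|left]; exact: mnm1Mn_ne.
have -> : (U_(o') *+ l' <= mu + U_(o) *+ l)%MM = (U_(o') *+ l' <= mu)%MM.
  by apply/mnm_lepP/mnm_lepP => le i; move: (le i) (h i); rewrite mnmDE; lia.
case: ifP => // /mnm_lepP le; congr (g _); apply/mnmP => i.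
by move: (le i) (h i); rewrite mnmDE !mnmBE mnmDE; lia.
Qed.

Lemma mslice_mshift (o o' : 'I_p) j l g : o != o' ->
  mslice o j (mshift (U_(o') *+ l)%MM g) = mshift (U_(o') *+ l)%MM (mslice o j g).
Proof.
move=> ne; apply/funext=> mu; rewrite /mslice /mshift mnmBE (mnm1Mn_ne _ ne) subn0.
by case: ifP; case: ifP.
Qed.

Lemma mslice_mshift_eq (o : 'I_p) j l g :
  mslice o (l + j) (mshift (U_(o) *+ l)%MM g) = mshift (U_(o) *+ l)%MM (mslice o j g).
Proof.
apply/funext=> mu; rewrite /mslice /mshift mnmBE mulmnE mnm1E eqxx mul1n.
case: (boolP (_ <= _)%MM) => [/mnm_lepP/(_ o)|]; last by rewrite if_same.
by rewrite mulmnE mnm1E eqxx mul1n => le; rewrite -{1}(subnKC le) eqn_add2l.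
Qed.

End PolynomialsOverModule.

Section GenericForms.
Variables (K : fieldType) (k : nat) (M : lmodType {mpoly K[k]}) (p : nat).
Local Notation S := {mpoly K[k]}.
Implicit Types (g : 'X_{1..p.+1} -> M).

(* Multiplication by the linear form with the powers 1, t, t^2, ... of the s-th
   parameter t as coefficients. *)
Definition generic_form (s : nat) g : 'X_{1..p.+1} -> M :=
  \sum_(l < k) ('X_l : S) *: mshift (U_(inord s) *+ l)%MM g.

Lemma generic_form_linear s : linear (generic_form s).
Proof.
move=> c u v; rewrite /generic_form scaler_sumr -big_split /=; apply: eq_bigr => l _.
by rewrite linearP scalerDr !scalerA mulrC.
Qed.
HB.instance Definition _ s :=
  GRing.isLinear.Build S _ _ _ (generic_form s) (generic_form_linear s).

Lemma generic_formZ c s g : generic_form s (c *: g) = c *: generic_form s g.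
Proof. exact: linearZ_LR. Qed.

Lemma generic_formB s g g' :
  generic_form s (g - g') = generic_form s g - generic_form s g'.
Proof. exact: linearB. Qed.

Lemma fin_supp_generic_form s g : fin_supp g -> fin_supp (generic_form s g).
Proof.
by move=> hg; apply: fin_supp_sum => l _; apply: fin_suppZ; exact: fin_supp_mshift.
Qed.

Lemma generic_form_comm (G : {linear ('X_{1..p.+1} -> M) -> ('X_{1..p.+1} -> M)}) s :
  (forall l g, G (mshift (U_(inord s) *+ l)%MM g) =
    mshift (U_(inord s) *+ l)%MM (G g)) ->
  forall g, G (generic_form s g) = generic_form s (G g).
Proof.
by move=> h g; rewrite /generic_form raddf_sum; apply: eq_bigr => l _;
  rewrite /= linearZ_LR h.
Qed.

Lemma generic_formC u s g :
  generic_form u (generic_form s g) = generic_form s (generic_form u g).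
Proof.
apply: generic_form_comm => l h; apply/esym.
by apply: (generic_form_comm (G := mshift _)) => *; exact: mshiftC.
Qed.

Variable a : nat -> S.
Local Notation E := ('X_{1..p.+1} -> M).
Local Notation GF := (fun s => generic_form s : {linear E -> E}).
Local Notation U := (mixed_span (@fin_supp _ M p.+1) a GF).

Let UB := mixed_spanB (a := a) (F := GF) (@fin_suppB _ M p.+1).
Let UD := mixed_spanD (a := a) (F := GF) (@fin_supp0 _ M p.+1) (@fin_suppB _ M p.+1).
Let UZ := mixed_spanZ (a := a) (F := GF) (@fin_suppZ _ M p.+1).
Let Usum :=
  mixed_span_sum (a := a) (F := GF) (@fin_supp0 _ M p.+1) (@fin_suppB _ M p.+1).

Lemma mixed_span_scale s i (c : S) g :
  c@_0%MM = 0 -> (forall l : 'I_k, U s i (('X_l : S) *: g)) -> U s i (c *: g).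
Proof.
move=> c0 h; rewrite [c]mpolyE scaler_suml big_seq; apply: Usum => m mc.
have /existsP[l ml] : [exists l, m l != 0%N].
  apply: contraT => /existsPn m0; move: mc; rewrite mcoeff_msupp.
  suff -> : m = 0%MM by rewrite c0 eqxx.
  by apply/mnmP => l; rewrite mnm0E; apply/eqP/negPn/m0.
rewrite -(submK (_ : U_(l) <= m)%MM) ?lep1mP // mpolyXD scalerAl -scalerA.
exact/UZ/h.
Qed.

(* McCoy's argument: by induction on the degree of g in the s-th parameter,
   every variable, hence every polynomial without constant term, kills g modulo
   the span. *)
Lemma generic_form_regular s i : (s <= p)%N -> (a i)@_0%MM = 0 ->
  (forall g, fin_supp g -> U s i (a i *: g) -> U s i g) ->
  forall g, fin_supp g -> U s i (generic_form s g) -> U s i g.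
Proof.
move=> le_sp ai0 reg g fg; set o : 'I_p.+1 := inord s.
have ne_o u : (u < s)%N -> o != inord u.
  move=> lt; apply/eqP => /(congr1 val); rewrite /= !inordK //; first lia.
  by rewrite ltnS (leq_trans _ le_sp) // ltnW.
have Uslice j h : U s i h -> U s i (mslice o j h).
  apply: mixed_span_lin => [v|u v lt]; first exact: fin_supp_mslice.
  by apply: generic_form_comm => *; apply: mslice_mshift; exact: ne_o.
have Ushift m h : U s i h -> U s i (mshift m h).
  apply: mixed_span_lin => [v|u v lt]; first exact: fin_supp_mshift.
  by apply: generic_form_comm => *; exact: mshiftC.
have Ucontract l h : U s i h -> U s i (mcontract (U_(o) *+ l)%MM h).
  apply: mixed_span_lin => [v|u v lt]; first exact: fin_supp_mcontract.
  by apply: generic_form_comm => *; apply: mcontract_mshift; exact: ne_o.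
have [D hD] : exists D, forall mu : 'X_{1..p.+1}, (D <= mu o)%N -> g mu = 0.
  have [D hD] := fg; exists D => mu le; apply: hD; rewrite (leq_trans le) //.
  by rewrite mdegE (bigD1 o) //= leq_addr.
elim: D g fg hD => [|D IH] g fg hD Ug.
  by rewrite (_ : g = 0); [exact/mixed_span0/fin_supp0|apply/funext=> mu; exact: hD].
suff Xg : forall l : 'I_k, U s i (('X_l : S) *: g).
  by apply: reg => //; exact: mixed_span_scale.
(* Descending induction on l: the variables with the highest powers of t_s come first. *)
suff Xg c : forall l : 'I_k, (k <= l + c)%N -> U s i (('X_l : S) *: g).
  by move=> l; apply: (Xg k); rewrite leq_addl.
elim: c => [|c IHc] l lk; first by move: (ltn_ord l); lia.
(* The part of f_s g of degree l + D in t_s. Terms with j < l would need a slice of g of degree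
   above D, which vanishes; terms with j > l lie in the span by the inner induction. So x_l times
   the top slice lies in the span. *)
have top : mslice o (l + D) (generic_form s g) =
    ('X_l : S) *: mshift (U_(o) *+ l)%MM (mslice o D g) +
    \sum_(j < k | (l < j)%N)
      mslice o (l + D) (mshift (U_(o) *+ j)%MM (('X_j : S) *: g)).
  rewrite /generic_form raddf_sum (bigD1 l) //= msliceZ mslice_mshift_eq; congr (_ + _).
  rewrite (bigID (fun j : 'I_k => l < j)%N) /= addrC big1 => [|j /andP[jl lj]].
    rewrite add0r; apply: eq_big => [j|j _]; last by rewrite mshiftZ.
    by case: ltngtP; rewrite ?andbF ?andbT // => lj; apply/eqP => e; move: lj;
      rewrite e ltnn.
  have {jl lj} jl : (j < l)%N.
    by rewrite ltn_neqAle leqNgt lj andbT; apply: contra_neq jl => /val_inj.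
  rewrite msliceZ -(subnKC (ltnW jl)) -addnA mslice_mshift_eq.
  rewrite (_ : mslice _ _ g = 0) ?linear0 ?scaler0 //.
  apply/funext => mu; rewrite /mslice; case: eqP => // e; apply: hD; rewrite e; lia.
have UlD : U s i (('X_l : S) *: mslice o D g).
  rewrite -(mshiftK (U_(o) *+ l)%MM (mslice o D g)) -mcontractZ; apply: Ucontract.
  move: (Uslice (l + D)%N _ Ug); rewrite top => /UB; rewrite -[X in U s i X](addrK
   (\sum_(j < k | (l < j)%N)
     mslice o (l + D) (mshift (U_(o) *+ j)%MM (('X_j : S) *: g)))).
  apply; apply: Usum => j lj; apply/Uslice/Ushift/IHc.
  by move: lj lk; lia.
(* The outer induction applies to x_l (g - top slice): its degree in t_s is below D, and f_s sends
   it into the span because both x_l f_s g and f_s (x_l top slice) lie there. *)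
rewrite -(subrK (mslice o D g) g) scalerDr; apply: UD => //; apply: IH.
- by apply: fin_suppZ; apply: fin_suppB => //; exact: fin_supp_mslice.
- move=> mu le; rewrite !fctE /mslice; case: eqP => [_|ne];
  first by rewrite subrr scaler0.
  by rewrite subr0 hD ?scaler0 //; lia.
rewrite scalerBr generic_formB generic_formZ; apply: UB; first exact: UZ.
apply: (mixed_spanF (F := GF)) => //.
- exact: fin_supp_generic_form.
- exact: generic_formC.
Qed.

Theorem generic_regular_seq r :
  (r <= p.+1)%N ->
  (forall i, (i < r)%N -> (a i)@_0%MM = 0) ->
  (forall i (v : M), (i < r)%N ->
     (exists z : nat -> M, a i *: v = \sum_(j < i) a j *: z j) ->
     exists z : nat -> M, v = \sum_(j < i) a j *: z j) ->
  forall s g, (s < r)%N -> fin_supp g -> U s 0 (generic_form s g) -> U s 0 g.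
Proof.
move=> le_rp a0 reg.
apply: (F_regular_seq (F := GF) (@fin_supp0 _ M p.+1) (@fin_suppB _ M p.+1)
  fin_supp_generic_form generic_formC
  (r := r)) => // [i v lt_ir [D hD] [w [z [fw fz]]]|s' i lt Ureg].
  rewrite big_ord0 add0r => e.
  (* The sequence stays regular on M[t] because it acts coefficient by coefficient. The witnesses
     are set to 0 in degrees from D on, so that they have finite support. *)
  have /choice[y hy] (mu : 'X_{1..p.+1}) : exists y : nat -> M,
      v mu = \sum_(j < i) a j *: y j /\ ((D <= mdeg mu)%N -> forall j, y j = 0).
    have [le|gt] := leqP D (mdeg mu).
      exists (fun=> 0); rewrite hD //; split=> //; rewrite big1 // => j _;
        exact: scaler0.
    have [|y hy] := reg i (v mu) lt_ir; last by exists y.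
    exists (fun j => z j mu); have := congr1 (@^~ mu) e; rewrite /= fct_sumE => <-.
    by [].
  exists (fun=> 0), (fun j mu => y mu j); split=> [_|j|]; first exact: fin_supp0.
    by exists D => mu le; exact: (hy mu).2.
  rewrite big_ord0 add0r; apply/funext=> mu; rewrite fct_sumE (hy mu).1.
  by [].
apply: generic_form_regular => //; last by apply: a0; lia.
by rewrite -ltnS (leq_trans _ le_rp) //; lia.
Qed.

End GenericForms.

(** * Positivity from depth *)

Section RankOfRegularForms.
Variables (L : fieldType) (H : nat -> nat) (F : nat -> forall d, 'M[L]_(H d, H d.+1)).
Variable (r : nat).

(** The degree d part of (f_0, ..., f_(s-1))N, as a row space. It is 0 in degree 0 because there is
    no piece of degree -1 to multiply. *)
Definition form_span (s d : nat) : 'M[L]_(H d) :=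
  match d return 'M[L]_(H d) with
  | 0 => 0
  | e.+1 => (\sum_(u < s) <<F u e>>)%MS
  end.

Hypothesis F_comm : forall u s d, F u d *m F s d.+1 = F s d *m F u d.+1.
Hypothesis F_reg : forall s d (v : 'rV[L]_(H d)), (s < r)%N ->
  (v *m F s d <= form_span s d.+1)%MS -> (v <= form_span s d)%MS.

Lemma form_span_mul s d : (form_span s d *m F s d <= form_span s d.+1)%MS.
Proof.
case: d => [|d]; first by rewrite mul0mx sub0mx.
rewrite /= sumsmxMr_gen; apply/sumsmx_subP => u _.
rewrite genmxE (eqmxMr _ (genmxE _)) F_comm.
by rewrite (submx_trans (submxMl _ _)) // -(genmxE (F u d.+1)) (sumsmx_sup u).
Qed.

(** With J = (f_0, ..., f_(s-1))N, this counts dimensions in 0 -> (N/J)_d -> (N/J)_(d+1) -> (N/(J +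
    f_s N))_(d+1) -> 0; regularity of f_s is exactness on the left. Multiplication by [cokermx]
    plays the part of the quotient map. *)
Lemma rank_form_spanS s d : (s < r)%N ->
  (\rank (form_span s.+1 d.+1) + \rank (form_span s d) =
   \rank (form_span s d.+1) + H d)%N.
Proof.
move=> sr; set W := form_span s d.+1; set C := cokermx W.
have kerE : (kermx (F s d *m C) == form_span s d)%MS.
  apply/andP; split; last first.
    apply/sub_kermxP; rewrite mulmxA; apply/eqP; rewrite -submxE; exact: form_span_mul.
  apply/row_subP => i; apply: F_reg => //; rewrite submxE -mulmxA -row_mul.
  by rewrite mulmx_ker row0.
have -> : form_span s.+1 d.+1 = (W + <<F s d>>)%MS by rewrite /W /= big_ord_recr.
have rk : \rank (F s d *m C) = (H d - \rank (form_span s d))%N.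
  by rewrite -(eqmxP kerE) mxrank_ker subKn // rank_leq_row.
have rk1 : \rank ((W + <<F s d>>)%MS *m C) = \rank (F s d *m C).
  by rewrite addsmxMr mulmx_coker adds0mx (eqmxMr _ (genmxE _)).
have capE : ((W + <<F s d>>) :&: kermx C :=: W)%MS.
  apply/eqmxP/andP; split.
    apply: submx_trans (capmxSr _ _) _; rewrite submxE; exact/eqP/mulmx_ker.
  by rewrite sub_capmx addsmxSl; apply/sub_kermxP; exact: mulmx_coker.
rewrite -(mxrank_mul_ker (W + <<F s d>>)%MS C) rk1 rk capE.
have := rank_leq_row (form_span s d); lia.
Qed.

Lemma corank_form_span s d : (s <= r)%N ->
  (H d)%:Z - (\rank (form_span s d))%:Z = iter s diff (fun d => (H d)%:Z) d.
Proof.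
elim: s d => [|s IH] d sr.
  by case: d => [|d]; rewrite /= ?big_ord0 mxrank0 subr0.
rewrite iterS /diff; case: d => [|d]; first by rewrite -IH ?(ltnW sr) //= mxrank0
  !subr0.
rewrite -!IH ?(ltnW sr) //; have := rank_form_spanS d sr; lia.
Qed.

Lemma iter_diff_dim_ge0 d : 0 <= iter r diff (fun d => (H d)%:Z) d.
Proof. by rewrite -corank_form_span // subr_ge0 lez_nat rank_leq_row. Qed.

End RankOfRegularForms.

Lemma mcoeffMX_sub (R : nzRingType) n (q : {mpoly R[n]}) m mu :
  (q * 'X_[m])@_mu = if (m <= mu)%MM then q@_(mu - m) else 0.
Proof.
case: ifP => le; first by rewrite -{1}(submK le) addmC mcoeffMX.
apply: memN_msupp_eq0; rewrite (perm_mem (msuppMX _ _)); apply/mapP => -[m' _ e].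
by move: le; rewrite e lem_addr.
Qed.

Lemma common_denominator (T : idomainType) (I : finType) (v : I -> {fraction T}) :
  exists2 c : T, c != 0 & exists w : I -> T, forall i, tofrac c * v i = tofrac (w i).
Proof.
have frac x : exists2 y : T * T, y.2 != 0 & tofrac y.2 * x = tofrac y.1 :> {fraction T}.
  have y0 := denom_ratioP (repr x); exists (\n_(repr x), \d_(repr x)) => //=.
  rewrite -{2}[x]reprK -[repr x]Ratio_numden; move: y0; set n := \n_ _;
    set d := \d_ _ => d0.
  have -> : \pi_({fraction T}) (Ratio n d) = tofrac n / tofrac d.
    rewrite !piE /FracField.mulf /FracField.invf !numden_Ratio ?oner_eq0 //.
    by rewrite mulr1 mul1r.
  by rewrite !numden_Ratio // mulrCA divff ?mulr1 // tofrac_eq0.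
have /choice[y hy] i : exists y : T * T, y.2 != 0 /\ tofrac y.2 * v i = tofrac y.1.
  by have [y] := frac (v i); exists y.
exists (\prod_i (y i).2); first by apply/prodf_neq0 => i _; exact: (hy i).1.
exists (fun i => (\prod_(j | j != i) (y j).2) * (y i).1) => i.
by rewrite (bigD1 i) //= !tofracM mulrAC (hy i).2 mulrC.
Qed.

(** * From a regular sequence to matrices over the fraction field *)

Section PositivityFromDepth.
Variables (K : fieldType) (k : nat) (N : gradedModule K k).
Hypothesis N_fg : finitely_generated N.
Hypothesis N_neg : hilbert_series N (-1) = 0%N.
Variables (fs : seq {mpoly K[k]}).
Hypothesis fs0 : {in fs, forall f : {mpoly K[k]}, f@_0%MM = 0}.
Hypothesis fs_reg : regular_seq N fs.

Local Notation S := {mpoly K[k]}.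
Local Notation p := (size fs).
Local Notation T := {mpoly K[p.+1]}.
Local Notation L := {fraction T}.
Local Notation piece := (@gm_piece K k N).
Let H (d : nat) := hilbert_series N d%:Z.

Let b (d : nat) : 'I_(H d) -> N := sval (cid (hilbert_series_basis N_fg d%:Z)).
Let b_basis d : is_basis (piece d%:Z) (@b d) :=
  svalP (cid (hilbert_series_basis N_fg d%:Z)).

Lemma piece_neg v : piece (-1) v -> v = 0.
Proof.
have [c [_ _ sc]] := hilbert_series_basis N_fg (-1).
by move=> /sc[e ->]; move: c e {sc}; rewrite N_neg => c e; rewrite big_ord0.
Qed.

Lemma piece_mulX (l : 'I_k) (d : nat) v :
  piece d%:Z v -> piece d.+1%:Z (('X_l : S) *: v).
Proof. by move=> h; rewrite intS; apply: gm_pieceZ => //; rewrite dhomogX /= mdeg1. Qed.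

Lemma variable_matrix (l : 'I_k) (d : nat) : exists A : 'M[K]_(H d, H d.+1),
  forall i, ('X_l : S) *: b i = \sum_j (A i j)%:MP *: b j.
Proof.
have /choice[c hc] (i : 'I_(H d)) : exists c : 'I_(H d.+1) -> K,
    ('X_l : S) *: b i = \sum_j (c j)%:MP *: b j.
  by have [_ _ sb] := b_basis d.+1; apply/sb/piece_mulX; case: (b_basis d).
by exists (\matrix_(i, j) c i j) => i; rewrite hc; apply: eq_bigr => j _; rewrite mxE.
Qed.

Let X (l : 'I_k) d := sval (cid (variable_matrix l d)).
Let XE l d i : ('X_l : S) *: b i = \sum_j (X l d i j)%:MP *: b j :=
  svalP (cid (variable_matrix l d)) i.

(** Coordinates for the degree d part of N[t]: rows of polynomials in t correspond to the finitely
    supported functions with values in that piece, by [poly_vector_inj] and [poly_vector_surj]. *)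
Definition poly_vector d (v : 'rV[T]_(H d)) : 'X_{1..p.+1} -> N :=
  fun mu => \sum_i ((v 0 i)@_mu)%:MP *: b i.

Lemma poly_vector_inj d (v w : 'rV[T]_(H d)) : poly_vector v = poly_vector w -> v = w.
Proof.
move=> e; apply/rowP => i; apply/mpolyP => mu; apply/eqP; rewrite -subr_eq0; apply/eqP.
have [_ ib _] := b_basis d; apply: (ib (fun i => (v 0 i)@_mu - (w 0 i)@_mu)).
under eq_bigr do rewrite rmorphB scalerBl.
rewrite sumrB; apply/eqP; rewrite subr_eq0; apply/eqP.
exact: (congr1 (@^~ mu) e).
Qed.

Lemma poly_vectorD d (v w : 'rV[T]_(H d)) :
  poly_vector (v + w) = poly_vector v + poly_vector w.
Proof.
apply/funext => mu; rewrite fctE /poly_vector -big_split; apply: eq_bigr => i _.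
by rewrite mxE mcoeffD rmorphD scalerDl.
Qed.

Lemma poly_vector0 d : poly_vector (0 : 'rV[T]_(H d)) = 0.
Proof.
by apply/funext => mu; apply: big1 => i _; rewrite mxE mcoeff0 mpolyC0 scale0r.
Qed.

Lemma poly_vector_sum d (n : nat) (v : nat -> 'rV[T]_(H d)) :
  poly_vector (\sum_(u < n) v u) = \sum_(u < n) poly_vector (v u).
Proof.
by elim: n => [|n IH]; rewrite ?big_ord0 ?poly_vector0 // !big_ord_recr /= poly_vectorD
  IH.
Qed.

Lemma poly_vector_piece d (v : 'rV[T]_(H d)) mu : piece d%:Z (poly_vector v mu).
Proof.
by apply: gm_piece_sum => i _; apply: gm_pieceC; case: (b_basis d).
Qed.

Lemma fin_supp_poly_vector d (v : 'rV[T]_(H d)) : fin_supp (poly_vector v).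
Proof.
exists (\max_i msize (v ord0 i))%N => mu le; apply: big1 => i _.
rewrite (memN_msupp_eq0 (m := mu)) ?mpolyC0 ?scale0r //.
apply: msize_mdeg_ge; apply: leq_trans _ le.
exact: (@leq_bigmax _ (fun i : 'I_(H d) => msize (v ord0 i)) i).
Qed.

Lemma poly_vector_surj d (g : 'X_{1..p.+1} -> N) : fin_supp g ->
  (forall mu, piece d%:Z (g mu)) -> exists v : 'rV[T]_(H d), g = poly_vector v.
Proof.
move=> [D hD] hg; have /choice[c hc] (mu : 'X_{1..p.+1}) : exists c : 'I_(H d) -> K,
    g mu = \sum_i (c i)%:MP *: b i by have [_ _ sb] := b_basis d; exact/sb/hg.
exists (\row_i \sum_(m : 'X_{1..p.+1 < D}) c m i *: 'X_[m] : 'rV[T]_(H d)).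
apply/funext => mu; rewrite /poly_vector.
have [le|lt] := leqP D (mdeg mu).
  rewrite hD // big1 // => i _; rewrite mxE raddf_sum /= big1 ?mpolyC0 ?scale0r // =>
    m _.
  rewrite mcoeffZ mcoeffX; case: eqP => [e|]; last by rewrite mulr0.
  by have := bmdeg m; rewrite e ltnNge le.
by rewrite hc; apply: eq_bigr => i _; rewrite mxE (mcoeff_mpoly (fun m => c m i)).
Qed.

Definition form_matrix (u d : nat) : 'M[T]_(H d, H d.+1) :=
  \sum_(l < k) 'X_[U_(inord u) *+ l] *: map_mx (@mpolyC p.+1 K) (X l d).

Lemma poly_vector_form u d (v : 'rV[T]_(H d)) :
  poly_vector (v *m form_matrix u d) = generic_form u (poly_vector v).
Proof.
rewrite /generic_form /form_matrix mulmx_sumr; apply/funext => mu.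
rewrite fct_sumE.
have -> :
    poly_vector (\sum_(l < k)
      v *m ('X_[U_(inord u) *+ l] *: map_mx (@mpolyC p.+1 K) (X l d))) mu =
    \sum_(l < k)
      poly_vector (v *m ('X_[U_(inord u) *+ l] *: map_mx (@mpolyC p.+1 K) (X l d))) mu.
  elim/big_rec2: _ => [|l y z _ <-]; first by rewrite poly_vector0.
  by rewrite poly_vectorD.
apply: eq_bigr => l _; rewrite fctE /mshift /poly_vector.
have coefE j : (v *m ('X_[U_(inord u) *+ l] *: map_mx (@mpolyC p.+1 K) (X l d))) 0 j =
    (\sum_i v 0 i * (X l d i j)%:MP) * 'X_[U_(inord u) *+ l].
  rewrite -scalemxAr !mxE mulrC; congr (_ * _).
  by apply: eq_bigr => i _; rewrite mxE.
under eq_bigr do rewrite coefE mcoeffMX_sub.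
case: ifP => le; last by rewrite scaler0 big1 // => j _; rewrite mpolyC0 scale0r.
under eq_bigr do rewrite raddf_sum /= rmorph_sum scaler_suml.
rewrite exchange_big scaler_sumr /=; apply: eq_bigr => i _.
rewrite scalerA mulrC -scalerA XE scaler_sumr; apply: eq_bigr => j _.
by rewrite scalerA -rmorphM mulrC mcoeffCM mulrC.
Qed.

Lemma X_comm l l' d : X l d *m X l' d.+1 = X l' d *m X l d.+1.
Proof.
have e l1 l2 i : ('X_l2 : S) *: (('X_l1 : S) *: b i) =
    \sum_j ((X l1 d *m X l2 d.+1) i j)%:MP *: b j.
  rewrite XE scaler_sumr; under eq_bigr do rewrite scalerA mulrC -scalerA XE
    scaler_sumr.
  rewrite exchange_big /=; apply: eq_bigr => j _; rewrite mxE rmorph_sum scaler_suml.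
  by apply: eq_bigr => m _; rewrite scalerA -rmorphM.
apply/matrixP => i j; apply/eqP; rewrite -subr_eq0; apply/eqP.
have [_ ib _] := b_basis d.+2.
apply: (ib (fun j => (X l d *m X l' d.+1) i j - (X l' d *m X l d.+1) i j)).
under eq_bigr do rewrite rmorphB scalerBl.
by rewrite sumrB -!e !scalerA mulrC subrr.
Qed.

Lemma form_matrixC u s d :
  form_matrix u d *m form_matrix s d.+1 = form_matrix s d *m form_matrix u d.+1.
Proof.
rewrite /form_matrix !mulmx_suml; under eq_bigr do rewrite mulmx_sumr.
under [RHS]eq_bigr do rewrite mulmx_sumr.
rewrite exchange_big; apply: eq_bigr => l _; apply: eq_bigr => l' _.
by rewrite -!scalemxAl -!scalemxAr !scalerA -!map_mxM X_comm mulrC.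
Qed.

Definition frac_form u d : 'M[L]_(H d, H d.+1) := map_mx (@tofrac T) (form_matrix u d).

Lemma gcomp_generic_form u d (g : 'X_{1..p.+1} -> N) :
  (gcomp (1 + d) \o generic_form u g) = generic_form u (gcomp d \o g).
Proof.
apply/funext => mu; rewrite /generic_form /= !fct_sumE raddf_sum;
  apply: eq_bigr => l _ /=.
rewrite !fctE gcompZ ?dhomogX /= ?mdeg1 // /mshift /=.
by case: ifP => // _; rewrite raddf0.
Qed.

Lemma fin_supp_gcomp d (g : 'X_{1..p.+1} -> N) : fin_supp g -> fin_supp (gcomp d \o g).
Proof. by move=> [D hD]; exists D => mu le /=; rewrite hD // raddf0. Qed.

(** [generic_regular_seq] read in coordinates. The case distinction on d mirrors [form_span]: for d
    = 0 the witnesses would have degree -1, where N vanishes. *)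
Lemma form_matrix_regular s d (v : 'rV[T]_(H d)) (w : nat -> 'rV[T]_(H d)) :
  (s < p)%N ->
  v *m form_matrix s d = \sum_(u < s) w u *m form_matrix u d ->
  match d return 'rV[T]_(H d) -> Prop with
  | 0 => fun v => v = 0
  | e.+1 => fun v =>
      exists w : nat -> 'rV[T]_(H e), v = \sum_(u < s) w u *m form_matrix u e
  end v.
Proof.
move=> sp e.
have [g [z [fg _]]] : mixed_span (@fin_supp _ N p.+1) (fun i => fs`_i)
    (fun s => generic_form s) s 0 (poly_vector v).
  apply: (generic_regular_seq (r := p)) => //.
  - by move=> i ip; apply: fs0; exact: mem_nth.
  - move=> i x ip [z ez].
    have sz : size (take i fs) = i by rewrite size_take ip.
    have [|y ->] := fs_reg.1 i x ip.
      by exists z; rewrite ez sz; apply: eq_bigr => j _; rewrite nth_take.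
    by exists y; rewrite sz; apply: eq_bigr => j _; rewrite nth_take.
  - exact: fin_supp_poly_vector.
  rewrite -poly_vector_form e (poly_vector_sum s (fun u => w u *m form_matrix u d)).
  exists (fun u => poly_vector (w u)), (fun=> 0); split=> [u|_|].
  - exact: fin_supp_poly_vector.
  - exact: fin_supp0.
  by rewrite big_ord0 addr0; apply: eq_bigr => u _; exact: poly_vector_form.
rewrite big_ord0 addr0 => {}e.
(* The witnesses g u need not be homogeneous. Each form raises degrees by 1, so taking degree d
   components replaces g u by its component of degree d - 1. *)
have {e} e (d' : int) : d%:Z = 1 + d' ->
    poly_vector v = \sum_(u < s) generic_form u (gcomp d' \o g u).
  move=> ed; apply/funext => mu; rewrite fct_sumE.
  rewrite -(gcomp_homog (poly_vector_piece v mu)) e ed fct_sumE raddf_sum.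
  by apply: eq_bigr => u _; rewrite -gcomp_generic_form.
case: d v w e => [|d] v w e.
  apply: poly_vector_inj; rewrite (e (-1)) // poly_vector0 big1 // => u _.
  rewrite (_ : _ \o _ = 0) ?raddf0 //; apply/funext => mu.
  exact/piece_neg/gcomp_piece.
have /choice[y hy] (u : nat) : exists y : 'rV[T]_(H d), gcomp d \o g u = poly_vector y.
  by apply: poly_vector_surj => [|mu]; [exact: fin_supp_gcomp|exact: gcomp_piece].
exists y; apply: poly_vector_inj.
rewrite (e d) ?intS // (poly_vector_sum s (fun u => y u *m form_matrix u d)).
by apply: eq_bigr => u _; rewrite hy poly_vector_form.
Qed.

Lemma frac_form_regular s d (v : 'rV[L]_(H d)) : (s < p)%N ->
  (v *m frac_form s d <= form_span frac_form s d.+1)%MS ->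
  (v <= form_span frac_form s d)%MS.
Proof.
move=> sp /sub_sumsmxP[w' ew'].
have /choice[w hw] (u : 'I_s) : exists w : 'rV[L]_(H d), w' u *m <<frac_form u d>>%MS =
  w *m frac_form u d.
  by apply/submxP; rewrite (submx_trans (submxMl _ _)) // genmxE.
have {ew'} e : v *m frac_form s d = \sum_(u < s) w u *m frac_form u d.
  by rewrite ew'; apply: eq_bigr => u _; exact: hw.
(* One denominator serves v and all witnesses at once: they form a single family in which [None]
   stands for v. *)
have [c c0 [y hy]] := common_denominator
  (fun x : option 'I_s * 'I_(H d) => (if x.1 is Some u then w u else v) 0 x.2).
pose v1 : 'rV[T]_(H d) := \row_i y (None, i).
pose w1 (u : nat) : 'rV[T]_(H d) := \row_i if insub u is Some u then y (Some u, i) else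
  0.
have ev : tofrac c *: v = map_mx (@tofrac T) v1 by apply/rowP => i;
  rewrite !mxE (hy (None, i)).
have ew (u : 'I_s) : tofrac c *: w u = map_mx (@tofrac T) (w1 u).
  by apply/rowP => i; rewrite !mxE valK (hy (Some u, i)).
have {e} e : v1 *m form_matrix s d = \sum_(u < s) w1 u *m form_matrix u d.
  have : tofrac c *: (v *m frac_form s d) =
    tofrac c *: \sum_(u < s) w u *m frac_form u d.
    by rewrite e.
  rewrite scaler_sumr scalemxAl ev -map_mxM.
  under eq_bigr do rewrite scalemxAl ew -map_mxM.
  rewrite -raddf_sum => /matrixP h; apply/matrixP => i j.
  by have := h i j; rewrite !mxE => /eqP; rewrite tofrac_eq => /eqP.
have cF : tofrac c != 0 :> L by rewrite tofrac_eq0.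
have -> : v = (tofrac c)^-1 *: map_mx (@tofrac T) v1
  by rewrite -ev scalerA mulVf // scale1r.
apply: scalemx_sub; have := form_matrix_regular sp e; move: (v1).
case: (d) => [|d'] v2; first by move=> ->; rewrite map_mx0 sub0mx.
move=> [x ->]; rewrite raddf_sum /=; apply: summx_sub => u _.
rewrite map_mxM (submx_trans (submxMl _ _)) // -(genmxE (map_mx _ _)).
by rewrite (sumsmx_sup u).
Qed.

Theorem regular_seq_positive d :
  0 <= iter (size fs) diff (fun d : nat => (hilbert_series N d%:Z)%:Z) d.
Proof.
apply: (iter_diff_dim_ge0 (F := frac_form)) => [u s e|s e v];
  last exact: frac_form_regular.
by rewrite -!map_mxM form_matrixC.
Qed.

End PositivityFromDepth.

(** * Monomial quotients *)

Section MonomialCount.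
Variable k : nat.
Implicit Types (Q : pred 'X_{1..k}) (J : {set 'I_k}) (a : 'X_{1..k}).

Definition mnm_count Q (d : nat) : nat :=
  #|[pred a : 'X_{1..k < d.+1} | (mdeg a == d) && Q a]|.

Lemma eq_mnm_count Q Q' : Q =1 Q' -> mnm_count Q =1 mnm_count Q'.
Proof. by move=> e d; apply: eq_card => a; rewrite !inE e. Qed.

Lemma mnm_countU Q Q' d :
  (mnm_count (predU Q Q') d + mnm_count (predI Q Q') d =
    mnm_count Q d + mnm_count Q' d)%N.
Proof.
rewrite /mnm_count -[RHS]cardUI; congr (_ + _)%N; apply: eq_card => a; rewrite !inE /=.
  by rewrite andb_orr.
by case: (mdeg a == d).
Qed.

(** Multiplication by x_l is a bijection from the Q-monomials of degree d onto those of degree d + 1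
    divisible by x_l; the difference counts the rest. *)
Lemma diff_mnm_count Q l d : (forall a, Q (a + U_(l))%MM = Q a) ->
  diff (fun d => (mnm_count Q d)%:Z) d =
    (mnm_count (fun a => Q a && (a l == 0%N)) d)%:Z.
Proof.
move=> Ql; rewrite /diff; case: d => [|d].
  rewrite subr0; congr Posz; apply: eq_card => a; rewrite !inE.
  case: eqP => //= /eqP; rewrite mdeg_eq0 => /eqP ->.
  by rewrite mnm0E eqxx andbT.
apply/eqP; rewrite subr_eq -PoszD eqz_nat; apply/eqP.
rewrite /mnm_count -(cardID [pred a : 'X_{1..k < d.+2} | a l == 0%N]).
congr (_ + _)%N; first by apply: eq_card => a; rewrite !inE /= andbA andbC.
have bnd (a : 'X_{1..k < d.+1}) : (mdeg (a + U_(l))%MM < d.+2)%N.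
  by rewrite mdegD mdeg1 addn1 ltnS bmdeg.
pose f (a : 'X_{1..k < d.+1}) := BMultinom (bnd a).
have f_inj : injective f by move=> a b /(congr1 val) /= /addIm /val_inj.
rewrite -(card_image f_inj); apply: eq_card => a; rewrite !inE /=.
apply/idP/mapP => [/and3P[al /eqP da Qa]|[a' + ->]].
  have la : (U_(l) <= a)%MM by rewrite lep1mP.
  have dl : mdeg (a - U_(l))%MM = d.
    by apply/eqP; rewrite -eqSS -addn1 -(mdeg1 l) -mdegD submK // da.
  have bl : (mdeg (a - U_(l))%MM < d.+1)%N by rewrite dl.
  exists (BMultinom bl); first by rewrite mem_enum inE /= dl eqxx -Ql submK.
  by apply: val_inj; rewrite /= submK.
rewrite mem_enum => /andP[/eqP da Qa].
by rewrite /= mnmDE mnm1E eqxx addn1 /= mdegD mdeg1 da addn1 eqxx Ql.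
Qed.

Definition mnm_supported J : pred 'X_{1..k} := fun a =>
  [forall l, (l \notin J) ==> (a l == 0%N)].

(** Induction on the size of J: multiplication by 1 - t removes one variable from J on the left and
    lowers the exponent by one on the right, and [diff_inj] cancels it. *)
Lemma mnm_count_supported J d : (mnm_count (mnm_supported J) d)%:Z = poly_dim #|J| d.
Proof.
move: {2}#|J| (erefl #|J|) d => c; elim: c J => [|c IH] J Jc d.
  rewrite Jc poly_dim0.
  have -> : mnm_count (mnm_supported J) d = (d == 0)%N.
    have J0 := cards0_eq Jc; case: d => [|d].
      rewrite /mnm_count (eq_card1 (x := bm0)) // => a; rewrite !inE.
      rewrite bmeqP -mdeg_eq0; apply: andb_idr; rewrite mdeg_eq0 => /eqP /= ->.
      by apply/forallP => l; rewrite mnm0E eqxx implybT.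
    apply: eq_card0 => a; rewrite !inE; apply/negP => /andP[/eqP da /forallP h].
    suff e : bmnm a = 0%MM by rewrite e mdeg0 in da.
    by apply/mnmP => l; move: (h l); rewrite J0 inE mnm0E => /eqP.
  by case: d.
have [l lJ] : exists l, l \in J by apply/set0Pn; rewrite -card_gt0 Jc.
move: d; apply: diff_inj => d; rewrite Jc diff_poly_dim (diff_mnm_count (l := l)) =>
  [|a].
  rewrite (eq_mnm_count (Q' := mnm_supported (J :\ l))) => [|a].
    have cJ : #|J :\ l| = c by move: (cardsD1 l J); rewrite lJ Jc => -[].
    by rewrite IH cJ.
  rewrite /mnm_supported; apply/andP/forallP => [[/forallP h al] j|h].
    by rewrite !inE negb_and negbK; apply/implyP => /orP[/eqP -> //|]; exact/implyP.
  split; last by move: (h l); rewrite !inE eqxx.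
  apply/forallP => j; apply/implyP => jJ; move: (h j); rewrite !inE negb_and jJ orbT.
  exact.
apply: eq_forallb => j; rewrite mnmDE mnm1E.
by case: (eqVneq l j) => [<-|_]; rewrite ?lJ // addn0.
Qed.

End MonomialCount.

Section MonomialQuotient.
Variables (K : fieldType) (k : nat) (gs : seq {mpoly K[k]}).
Hypothesis gs_homog : {in gs, forall g, g \is homog mdeg}.
Variable ms : seq 'X_{1..k}.
Hypothesis gsE : gs = [seq 'X_[m] | m <- ms].
Local Notation S := {mpoly K[k]}.
Local Notation Q := (quot_graded gs_homog).
Local Notation quo := (@to_quot K k gs).

Definition standard : pred 'X_{1..k} := fun a => ~~ has (fun m => m <= a)%MM ms.

Lemma ideal_pred_gen i : (i < size gs)%N -> gs`_i \in ideal_pred gs.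
Proof.
move=> lt; apply/ideal_predP; exists (fun j => (j == i)%:R).
rewrite (bigD1 (Ordinal lt)) //= eqxx mulr1 big1 ?addr0 // => j.
by rewrite -val_eqE /= => /negPf ->; rewrite mulr0.
Qed.

Lemma ideal_predX a : ~~ standard a -> ('X_[a] : S) \in ideal_pred gs.
Proof.
rewrite negbK => /hasP[m mms ma]; rewrite -(submK ma) mpolyXD; apply: ideal_predM.
have im : (index m ms < size ms)%N by rewrite index_mem.
have -> : 'X_[m] = gs`_(index m ms) by rewrite gsE (nth_map 0%MM) ?nth_index.
by apply: ideal_pred_gen; rewrite gsE size_map.
Qed.

Lemma nth_gens i : (i < size ms)%N -> gs`_i = 'X_[nth 0%MM ms i].
Proof. by move=> lt; rewrite gsE (nth_map 0%MM). Qed.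

Lemma monomial_idealP (p : S) :
  p \in ideal_pred gs <-> forall a, standard a -> p@_a = 0.
Proof.
split=> [/ideal_predP[u ->] a sa|h].
  rewrite raddf_sum big1 // => i _ /=.
  have im : (i < size ms)%N by rewrite -(size_map (fun m => 'X_[m] : S)) -gsE.
  have -> : gs`_i = 'X_[nth 0%MM ms i] by exact: nth_gens.
  rewrite mulrC mcoeffMX_sub; case: ifP => // le.
  by case/hasP: sa; exists (nth 0%MM ms i); rewrite ?mem_nth.
rewrite [p]mpolyE big_seq; apply: rpred_sum => a; rewrite mcoeff_msupp => pa.
rewrite -mul_mpolyC; apply: ideal_predM; apply: ideal_predX.
by apply: contra pa => /h ->.
Qed.

Lemma quoZ (p q : S) : p *: (quo q : Q) = quo (p * q).
Proof. exact: quot_scaleE. Qed.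

Lemma quot_graded_fg : finitely_generated Q.
Proof.
exists [:: quo 1] => v; have [p ->] := to_quot_surj v.
by exists (fun=> p); rewrite big_ord_recl big_ord0 addr0 /= [RHS]quoZ mulr1.
Qed.

Definition quot_dim (d : int) : nat :=
  if d is Posz d then mnm_count standard d else 0%N.

Lemma quot_graded_basis d : exists b : 'I_(quot_dim d) -> Q, is_basis (gm_piece d) b.
Proof.
case: d => [d|d]; last first.
  exists (fun=> 0); split=> [[]|c _ []|v [p p0 <-]] //.
  by exists (fun=> 0); rewrite big_ord0 (p0 : p = 0) raddf0.
pose A := [pred a : 'X_{1..k < d.+1} | (mdeg a == d) && standard a].
pose mon (i : 'I_#|A|) : 'X_{1..k} := enum_val i.
have mon_std i : mdeg (mon i) = d /\ standard (mon i).
  by have := enum_valP i; rewrite inE => /andP[/eqP].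
have mon_inj : injective mon by move=> i j /val_inj /enum_val_inj.
exists (fun i => quo 'X_[mon i]); split=> [i|c|v [p hp <-]].
- exists 'X_[mon i] => //; rewrite /poly_piece /= dhomogX; apply/eqP;
  exact: (mon_std i).1.
- under eq_bigr do rewrite quoZ; rewrite -raddf_sum => /to_quot_eq0/monomial_idealP h i.
  have := h _ (mon_std i).2; rewrite raddf_sum (bigD1 i) //= big1 => [|j ji].
    by rewrite addr0 mcoeffCM mcoeffX eqxx mulr1.
  by rewrite mcoeffCM mcoeffX (inj_eq mon_inj) (negPf ji) mulr0.
exists (fun i => p@_(mon i)).
under eq_bigr do rewrite quoZ; rewrite -raddf_sum; apply/subr0_eq.
rewrite -raddfB; apply/to_quot_eq0/monomial_idealP => a sa.
rewrite mcoeffB raddf_sum /=.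
have [da|da] := eqVneq (mdeg a) d; last first.
  rewrite (dhomog_nemf_coeff hp da) big1 ?subr0 // => i _.
  rewrite mcoeffCM mcoeffX; case: eqP => [e|]; last by rewrite mulr0.
  by move: da; rewrite -e (mon_std i).1 eqxx.
have bA : (mdeg a < d.+1)%N by rewrite da.
have inA : BMultinom bA \in A by rewrite inE /= da eqxx sa.
have [i ei] : exists i, mon i = a.
  by exists (enum_rank_in inA (BMultinom bA)); rewrite /mon enum_rankK_in.
rewrite (bigD1 i) //= big1 => [|j ji].
  by rewrite mcoeffCM mcoeffX ei eqxx mulr1 addr0 subrr.
by rewrite mcoeffCM mcoeffX -ei (inj_eq mon_inj) (negPf ji) mulr0.
Qed.

End MonomialQuotient.

(** * Shifts and direct sums *)

Section Shift.
Variables (K : fieldType) (k : nat) (N : gradedModule K k) (e : int).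
Let piece d : set N := gm_piece (d - e).

Lemma shift_pieceZ (f : nat) d (p : {mpoly K[k]}) v :
  p \is f.-homog -> piece d v -> piece (f%:Z + d) (p *: v).
Proof. by move=> hp hv; rewrite /piece -addrA; exact: gm_pieceZ. Qed.

Lemma shift_sum v : exists (s : seq int) (u : int -> N),
  (forall d, piece d (u d)) /\ v = \sum_(d <- s) u d.
Proof.
have [s [u [hu ->]]] := gm_sum v.
exists [seq d + e | d <- s], (fun d => u (d - e)); split=> [d|]; first exact: hu.
by rewrite big_map; apply: eq_bigr => d _; rewrite addrK.
Qed.

Lemma shift_direct (s : seq int) (u : int -> N) :
  uniq s -> (forall d, piece d (u d)) -> \sum_(d <- s) u d = 0 ->
  forall d, d \in s -> u d = 0.
Proof.
move=> us hu e0 d ds; have -> : u d = u ((d - e) + e) by rewrite subrK.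
apply: (@gm_direct _ _ N [seq d - e | d <- s] (fun d => u (d + e))).
- by rewrite map_inj_uniq //; exact: addIr.
- by move=> f; have := hu (f + e); rewrite /piece addrK.
- by rewrite big_map -[RHS]e0; apply: eq_bigr => f _; rewrite subrK.
- by apply/mapP; exists d.
Qed.

(** In the usual notation N(-e); its Hilbert series is t^e times that of N. *)
Definition shift_graded : gradedModule K k :=
  @GradedModule K k N piece (fun d => @gm_piece0 _ _ N _) (fun d => @gm_pieceD _ _ N _)
    shift_pieceZ shift_sum shift_direct.

End Shift.

Section DirectSum.
Variables (K : fieldType) (k : nat) (N1 N2 : gradedModule K k).
Local Notation S := {mpoly K[k]}.
Let M : lmodType S := (N1 * N2)%type.
Let piece d : set M := [set v | gm_piece d v.1 /\ gm_piece d v.2].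

Lemma dsum_piece0 d : piece d 0.
Proof. by split; exact: gm_piece0. Qed.

Lemma dsum_pieceD d u v : piece d u -> piece d v -> piece d (u + v).
Proof. by move=> [u1 u2] [v1 v2]; split; exact: gm_pieceD. Qed.

Lemma dsum_pieceZ (e : nat) d (p : S) v :
  p \is e.-homog -> piece d v -> piece (e%:Z + d) (p *: v).
Proof. by move=> hp [v1 v2]; split; exact: gm_pieceZ. Qed.

Lemma fst_sum (I : Type) (r : seq I) (f : I -> M) :
  (\sum_(i <- r) f i).1 = \sum_(i <- r) (f i).1.
Proof. by elim/big_rec2: _ => // i x y _ <-. Qed.

Lemma snd_sum (I : Type) (r : seq I) (f : I -> M) :
  (\sum_(i <- r) f i).2 = \sum_(i <- r) (f i).2.
Proof. by elim/big_rec2: _ => // i x y _ <-. Qed.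

Lemma dsum_sum v : exists (s : seq int) (u : int -> M),
  (forall d, piece d (u d)) /\ v = \sum_(d <- s) u d.
Proof.
case: v => v1 v2; have [c1 [h1 [s1 [us1 z1 e1]]]] := decomposition_exists v1.
have [c2 [h2 [s2 [us2 z2 e2]]]] := decomposition_exists v2.
exists (undup (s1 ++ s2)), (fun d => (c1 d, c2 d)); split=> [d|]; first by split.
apply: injective_projections; rewrite ?fst_sum ?snd_sum /=.
  rewrite e1; apply: sum_decomposition_widen; rewrite ?undup_uniq // => d.
  by rewrite mem_undup mem_cat => ->.
rewrite e2; apply: sum_decomposition_widen; rewrite ?undup_uniq // => d.
by rewrite mem_undup mem_cat orbC => ->.
Qed.

Lemma dsum_direct (s : seq int) (u : int -> M) :
  uniq s -> (forall d, piece d (u d)) -> \sum_(d <- s) u d = 0 ->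
  forall d, d \in s -> u d = 0.
Proof.
move=> us hu e d ds; apply/eqP; rewrite -pair_eqE /=; apply/andP; split; apply/eqP.
  apply: (gm_direct us (fun d => (hu d).1) _ ds).
  by rewrite -fst_sum e.
apply: (gm_direct us (fun d => (hu d).2) _ ds).
by rewrite -snd_sum e.
Qed.

Definition dsum_graded : gradedModule K k :=
  GradedModule dsum_piece0 dsum_pieceD dsum_pieceZ dsum_sum dsum_direct.

Lemma dsum_fg : finitely_generated N1 -> finitely_generated N2 ->
  finitely_generated dsum_graded.
Proof.
move=> [g1 h1] [g2 h2].
pose g : seq M := [seq (x, 0) | x <- g1] ++ [seq (0, x) | x <- g2].
have gl i : (i < size g1)%N -> g`_i = (g1`_i, 0).
  by move=> lt; rewrite nth_cat size_map lt (nth_map 0).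
have gr i : (i < size g2)%N -> g`_(size g1 + i) = (0, g2`_i).
  by move=> lt; rewrite nth_cat size_map ltnNge leq_addr /= addKn (nth_map 0).
exists g => -[v1 v2]; have [c1 e1] := h1 v1; have [c2 e2] := h2 v2.
exists (fun i => if (i < size g1)%N then c1 i else c2 (i - size g1)%N).
have -> : size (g : seq dsum_graded) = (size g1 + size g2)%N
  by rewrite size_cat !size_map.
rewrite big_split_ord /=.
have -> : \sum_(i < size g1) (if (i < size g1)%N then c1 i else c2 (i - size g1)%N) *:
    (g : seq dsum_graded)`_i = (v1, 0) :> M.
  apply: injective_projections; rewrite ?fst_sum ?snd_sum /=.
    by rewrite e1; apply: eq_bigr => i _; rewrite gl // ltn_ord.
  by rewrite big1 // => i _; rewrite gl //= scaler0.
have -> : \sum_(i < size g2) (if (size g1 + i < size g1)%N then c1 (size g1 + i)%N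
    else c2 (size g1 + i - size g1)%N) *: (g : seq dsum_graded)`_(size g1 + i) =
      (0, v2) :> M.
  apply: injective_projections; rewrite ?fst_sum ?snd_sum /=.
    by rewrite big1 // => i _; rewrite gr //= scaler0.
  by rewrite e2; apply: eq_bigr => i _; rewrite gr // ltnNge leq_addr /= addKn.
by apply: injective_projections; rewrite /= ?addr0 ?add0r.
Qed.

Lemma dsum_basis d r1 r2 (b1 : 'I_r1 -> N1) (b2 : 'I_r2 -> N2) :
  is_basis (gm_piece d) b1 -> is_basis (gm_piece d) b2 ->
  exists b : 'I_(r1 + r2) -> dsum_graded, is_basis (gm_piece d) b.
Proof.
move=> [A1 i1 s1] [A2 i2 s2].
pose b (i : 'I_(r1 + r2)) : M :=
  match fintype.split i with inl i => (b1 i, 0) | inr j => (0, b2 j) end.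
have bl i : b (lshift r2 i) = (b1 i, 0) by rewrite /b (fintype.unsplitK (inl i)).
have br j : b (rshift r1 j) = (0, b2 j) by rewrite /b (fintype.unsplitK (inr j)).
have sumE (c : 'I_(r1 + r2) -> K) : \sum_i (c i)%:MP *: b i =
    (\sum_i (c (lshift r2 i))%:MP *: b1 i, \sum_j (c (rshift r1 j))%:MP *: b2 j) :> M.
  rewrite big_split_ord /=; apply: injective_projections; rewrite /= ?fst_sum ?snd_sum.
    rewrite [X in _ + X]big1 => [|j _]; last by rewrite br /= scaler0.
    by rewrite addr0; apply: eq_bigr => i _; rewrite bl.
  rewrite big1 => [|i _]; last by rewrite bl /= scaler0.
  by rewrite add0r; apply: eq_bigr => i _; rewrite br.
exists b; split=> [i|c|[v1 v2] [/= /s1[c1 e1] /s2[c2 e2]]].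
- rewrite -[i]fintype.splitK; case: (fintype.split i) => j /=; rewrite ?bl ?br;
  split=> //=; exact: gm_piece0.
- rewrite [X in X = _]sumE => -[e1 e2] i; rewrite -[i]fintype.splitK;
  case: (fintype.split i) => j /=.
    exact: (i1 (fun i => c (lshift r2 i))).
  exact: (i2 (fun i => c (rshift r1 i))).
exists (fun i => match fintype.split i with inl i => c1 i | inr j => c2 j end).
rewrite [RHS]sumE e1 e2; congr (_, _); apply: eq_bigr => i _.
  by rewrite (fintype.unsplitK (inl i)).
by rewrite (fintype.unsplitK (inr i)).
Qed.

Lemma dsum_ideal_mul (fs : seq S) (v1 : N1) (v2 : N2) :
  ideal_mul fs ((v1, v2) : dsum_graded) <-> ideal_mul fs v1 /\ ideal_mul fs v2.
Proof.
split=> [[u e]|[[u1 ->] [u2 ->]]].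
  split; [exists (fun i => (u i).1)|exists (fun i => (u i).2)].
    by rewrite -[v1]/((v1, v2).1) [in LHS]e fst_sum.
  by rewrite -[v2]/((v1, v2).2) [in LHS]e snd_sum.
exists (fun i => (u1 i, u2 i)).
by apply: injective_projections; rewrite ?fst_sum ?snd_sum.
Qed.

End DirectSum.

(** * Suprema of sets of natural numbers *)

Lemma leq_nat_supremum (A : set nat) (B a : nat) :
  (forall b, A b -> (b <= B)%N) -> A a -> (a <= supremum 0%N A)%N.
Proof.
move=> AB Aa; rewrite -leEnat; apply: ge_supremum_Nmem => //.
by apply: nat_supremums_neq0; exists B.
Qed.

(** Empty and unbounded sets give the default 0. Otherwise the least upper bound s is a member,
    since s - 1 would bound the set if it were not. *)
Lemma nat_supremum_ind (A : set nat) (P : nat -> Prop) :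
  P 0%N -> (forall a, A a -> P a) -> P (supremum 0%N A).
Proof.
move=> P0 PA; rewrite /supremum; case: ifPn => // /set0P[a Aa].
case: xgetP => // s _ [us ls]; have [/PA //|nAs] := pselect (A s).
have lt a' : A a' -> (a' < s)%N.
  move=> Aa'; rewrite ltn_neqAle -[(a' <= s)%N]/(a' <= s)%O us // andbT.
  by apply/eqP => e; apply: nAs; rewrite -e.
have : (s <= s.-1)%O by apply: ls => a' /lt; rewrite leEnat; lia.
by rewrite leEnat; have := lt _ Aa; lia.
Qed.

(** * Variables as regular sequences on monomial quotients *)

Section VariableSequences.
Variables (K : fieldType) (k : nat).
Local Notation S := {mpoly K[k]}.

Lemma ideal_mul0 (M : lmodType S) (fs : seq S) : ideal_mul fs (0 : M).
Proof. by exists (fun=> 0); rewrite big1 // => i _; rewrite scaler0. Qed.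

Lemma ideal_mulD (M : lmodType S) (fs : seq S) (v w : M) :
  ideal_mul fs v -> ideal_mul fs w -> ideal_mul fs (v + w).
Proof.
move=> [u ->] [u' ->]; exists (fun i => u i + u' i).
by rewrite -big_split; apply: eq_bigr => i _; rewrite scalerDr.
Qed.

Lemma ideal_mul_gen (M : lmodType S) (fs : seq S) i (v : M) :
  (i < size fs)%N -> ideal_mul fs (fs`_i *: v).
Proof.
move=> lt; exists (fun j => if j == i then v else 0).
rewrite (bigD1 (Ordinal lt)) //= eqxx big1 ?addr0 // => j.
by rewrite -val_eqE /= => /negPf ->; rewrite scaler0.
Qed.

Definition vars (r : nat) : seq S := [seq 'X_l | l <- take r (enum 'I_k)].

Lemma size_vars r : (r <= k)%N -> size (vars r) = r.
Proof. by move=> rk; rewrite size_map size_take size_enum_ord; case: ltngtP rk. Qed.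

Lemma nth_vars r (l : 'I_k) : (l < r)%N -> (vars r)`_l = 'X_l.
Proof.
move=> lr; rewrite (nth_map l); last by rewrite size_take size_enum_ord;
  case: ifP => //.
by rewrite nth_take // nth_ord_enum.
Qed.

Lemma take_vars i r : (i <= r)%N -> take i (vars r) = vars i.
Proof. by move=> ir; rewrite -map_take take_takel. Qed.

Variables (gs : seq S) (gs_homog : {in gs, forall g, g \is homog mdeg}).
Variable ms : seq 'X_{1..k}.
Hypothesis gsE : gs = [seq 'X_[m] | m <- ms].
Local Notation Q := (quot_graded gs_homog).
Local Notation quo := (@to_quot K k gs).

Lemma ideal_mul_varsP r (p : S) : (r <= k)%N ->
  ideal_mul (vars r) (quo p : Q) <->
  forall a, standard ms a -> (forall l : 'I_k, (l < r)%N -> a l = 0%N) -> p@_a = 0.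
Proof.
move=> rk; split=> [[u e] a sa al|h].
  have [q hq] : exists q : nat -> S, forall i, u i = quo (q i).
    by have /choice[q hq] i := to_quot_surj (u i); exists q.
  have /to_quot_eq0/(monomial_idealP gsE)/(_ a sa) :
      quo (p - \sum_(i < size (vars r)) (vars r)`_i * q i) = 0.
    rewrite raddfB raddf_sum /= [in X in X - _]e; apply/eqP; rewrite subr_eq0;
      apply/eqP.
    by apply: eq_bigr => i _; rewrite hq quoZ.
  rewrite mcoeffB => /eqP; rewrite subr_eq0 => /eqP ->;
    rewrite raddf_sum big1 //= => i _.
  have ir : (i < r)%N by rewrite -{2}(size_vars rk).
  rewrite -[i : nat]/(val (Ordinal (leq_trans ir rk))) nth_vars // mulrC mcoeffMX_sub.
  by rewrite lep1mP al //= eqxx.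
rewrite [p]mpolyE raddf_sum /=; elim/big_rec: _ => [|a v _]; first exact: ideal_mul0.
apply: ideal_mulD; have [sa|nsa] := boolP (standard ms a); last first.
  have -> : quo (p@_a *: 'X_[a]) = 0; last exact: ideal_mul0.
  apply/to_quot_eq0; rewrite -mul_mpolyC; apply: ideal_predM; exact: (ideal_predX gsE).
have [/forallP al|/forallPn[l]] := boolP [forall l : 'I_k, (l < r)%N ==> (a l == 0%N)].
  rewrite h ?scale0r ?raddf0 //; first exact: ideal_mul0.
  by move=> l lr; apply/eqP; exact: (implyP (al l)).
rewrite negb_imply => /andP[lr la]; have le : (U_(l) <= a)%MM by rewrite lep1mP.
have -> : quo (p@_a *: 'X_[a]) = (vars r)`_l *: (quo (p@_a *: 'X_[a - U_(l)]) : Q).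
  by rewrite quoZ nth_vars // -scalerAr -mpolyXD addmC submK.
by apply: ideal_mul_gen; rewrite size_vars.
Qed.

(** The coefficient of p at a is that of x_i p at a + U_i, and the hypothesis keeps this exponent
    standard. Adding U_i does not touch the exponents of the earlier variables, so the criterion
    [ideal_mul_varsP] transfers. *)
Lemma vars_regular_quot r : (r <= k)%N ->
  (forall a (l : 'I_k), (l < r)%N -> standard ms (a + U_(l))%MM = standard ms a) ->
  forall i (v : Q), (i < r)%N ->
  ideal_mul (vars i) ((vars r)`_i *: v) -> ideal_mul (vars i) v.
Proof.
move=> rk inv i v ir; have [p ->] := to_quot_surj v; rewrite quoZ.
have ik := leq_trans ir rk; rewrite -[i in (vars r)`_i]/(val (Ordinal ik)) nth_vars //.
move=> /(ideal_mul_varsP _ (ltnW ik)) h; apply/(ideal_mul_varsP _ (ltnW ik)) => a sa al.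
have := h (a + U_(Ordinal ik))%MM; rewrite mulrC mcoeffMX_sub lem_addl addmK.
apply; first by rewrite inv.
move=> l li; rewrite mnmDE mnm1E al // -val_eqE /=.
by rewrite gtn_eqF.
Qed.

Lemma vars_proper_quot r : (r <= k)%N -> standard ms 0%MM ->
  ~ ideal_mul (vars r) (quo 1 : Q).
Proof.
move=> rk s0 /(ideal_mul_varsP _ rk)/(_ 0%MM s0) h.
suff : (1 : S)@_0%MM = 0 by rewrite mcoeff1 eqxx => /eqP; rewrite oner_eq0.
by apply: h => l _; rewrite mnm0E.
Qed.

End VariableSequences.

Section CoordinateModules.
Variables (K : fieldType) (k : nat).
Local Notation S := {mpoly K[k]}.

Definition coord_mons (c : nat) : seq 'X_{1..k} :=
  [seq U_(l)%MM | l : 'I_k <- enum 'I_k & (c <= l)%N].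
Definition coord_gens (c : nat) : seq S := [seq 'X_[m] | m <- coord_mons c].

Lemma monomials_homog (ms : seq 'X_{1..k}) :
  {in [seq 'X_[m] | m <- ms], forall g : S, g \is homog mdeg}.
Proof. by move=> g /mapP[m _ ->]; apply/homogP; exists (mdeg m); rewrite dhomogX. Qed.

Definition coord_quot c : gradedModule K k :=
  quot_graded (@monomials_homog (coord_mons c)).
(** The quotient by the unit ideal, generated by the monomial 1. Presented in this way, the zero
    module falls under the lemmas on monomial quotients. *)
Definition zero_graded : gradedModule K k := quot_graded (@monomials_homog [:: 0%MM]).

Lemma standard_coord c a : standard (coord_mons c) a =
  mnm_supported [set l : 'I_k | (l < c)%N] a.
Proof.
rewrite /standard -all_predC; apply/allP/forallP => [h l|h m /mapP[l]].
  rewrite inE -leqNgt; apply/implyP => cl; have := h U_(l)%MM; rewrite /= lep1mP negbK;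
    apply.
  by apply/mapP; exists l => //; rewrite mem_filter cl mem_enum.
rewrite mem_filter => /andP[cl _] ->; rewrite /= lep1mP negbK.
by have := h l; rewrite inE -leqNgt cl.
Qed.

Lemma card_ord_lt c : (c <= k)%N -> #|[set l : 'I_k | (l < c)%N]| = c.
Proof.
move=> ck; rewrite cardsE -sum1_card -(big_mkord (fun l => l < c)%N (fun=> 1%N)).
by rewrite -(big_nat_widen 0 c k xpredT) // sum_nat_const_nat subn0 muln1.
Qed.

Lemma coord_quot_dim c d : (c <= k)%N ->
  (mnm_count (standard (coord_mons c)) d)%:Z = poly_dim c d.
Proof.
by move=> ck; rewrite (eq_mnm_count (@standard_coord c)) mnm_count_supported
  card_ord_lt.
Qed.

Definition coord_sum (l : seq (nat * nat)) : gradedModule K k :=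
  foldr (fun x N => dsum_graded (shift_graded (coord_quot x.2) x.1%:Z) N) zero_graded l.

Lemma coord_sum_fg l : finitely_generated (coord_sum l).
Proof.
elim: l => [|x l IH]; first exact: quot_graded_fg.
by apply: dsum_fg => //; exact: (@quot_graded_fg K k _ (@monomials_homog _)).
Qed.

Lemma coord_sum_basis l (d : int) : {in l, forall x, (x.2 <= k)%N} ->
  exists n (b : 'I_n -> coord_sum l), is_basis (gm_piece d) b /\
    n%:Z = if d is Posz d then \sum_(x <- l) shift x.1 (poly_dim x.2) d else 0.
Proof.
elim: l => [|[s c] l IH] lk.
  have [b hb] := quot_graded_basis (@monomials_homog [:: 0%MM]) erefl d.
  exists (quot_dim [:: 0%MM] d), b; split=> //; case: d {b hb} => [d|] //=.
  rewrite big_nil; congr Posz; apply: eq_card0 => a; rewrite !inE /standard /=.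
  by rewrite (_ : (0 <= a)%MM) ?andbF //; apply/mnm_lepP => j; rewrite mnm0E.
have [|n [b [hb en]]] := IH; first by move=> x xl; apply: lk; rewrite inE xl orbT.
have [b' hb'] := quot_graded_basis (@monomials_homog (coord_mons c)) erefl (d - s%:Z).
have [b'' hb''] := @dsum_basis K k (shift_graded (coord_quot c) s%:Z) (coord_sum l) d _
  _ b' b hb' hb.
exists (quot_dim (coord_mons c) (d - s%:Z) + n)%N, b''; split=> //.
rewrite PoszD en; case: d {IH b hb en b' hb' b'' hb''} => [d|d] /=; last first.
  by rewrite addr0 (_ : Negz d - s%:Z = Negz (d + s)) // !NegzE; lia.
rewrite big_cons; congr (_ + _); rewrite /shift /=.
have ck : (c <= k)%N by apply: (lk (s, c)); rewrite inE eqxx.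
case: leqP => le; first by rewrite subzn // coord_quot_dim.
by rewrite (_ : d%:Z - s%:Z = Negz (s - d).-1) // NegzE; lia.
Qed.

Lemma coord_sum_regular l r : (r <= k)%N -> {in l, forall x, (r <= x.2)%N} ->
  forall i (v : coord_sum l), (i < r)%N ->
  ideal_mul (vars K k i) ((vars K k r)`_i *: v) -> ideal_mul (vars K k i) v.
Proof.
move=> rk; elim: l => [|[s c] l IH] lr i v ir.
  (* No monomial is standard for the unit ideal, so both sides of the invariance condition are
     false. *)
  by apply: (vars_regular_quot (ms := [:: 0%MM]) erefl rk) => // a j _;
    rewrite /standard /= !orbF; congr (~~ _); apply/mnm_lepP/mnm_lepP => _ h;
      rewrite mnm0E.
case: v => v1 v2 /dsum_ideal_mul[h1 h2]; apply/dsum_ideal_mul; split; last first.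
  by apply: IH h2 => // x xl; apply: lr; rewrite inE xl orbT.
apply: (vars_regular_quot (ms := coord_mons c) erefl rk _ ir h1) => a j jr.
rewrite !standard_coord; apply: eq_forallb => j'; rewrite inE mnmDE mnm1E -leqNgt.
have rc : (r <= c)%N by apply: (lr (s, c)); rewrite inE eqxx.
case: leqP => // cj; rewrite (_ : (j == j') = false) ?addn0 //.
by apply/eqP => e; move: (leq_trans jr (leq_trans rc cj)); rewrite e ltnn.
Qed.

Lemma coord_sum_proper l r : (r <= k)%N -> l != [::] ->
  exists v : coord_sum l, ~ ideal_mul (vars K k r) v.
Proof.
case: l => [//|[s c] l] rk _.
exists ((to_quot (coord_gens c) 1, 0) : coord_sum ((s, c) :: l)).
move=> /dsum_ideal_mul[h _]; move: h.
apply: (vars_proper_quot (ms := coord_mons c) erefl rk).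
by rewrite standard_coord; apply/forallP => j; rewrite mnm0E eqxx implybT.
Qed.

Lemma coord_sum_regular_seq l r : (r <= k)%N -> l != [::] ->
  {in l, forall x, (r <= x.2)%N} -> regular_seq (coord_sum l) (vars K k r).
Proof.
move=> rk l0 lr; split=> [i v|]; last exact: coord_sum_proper.
rewrite size_vars // => ir; rewrite take_vars ?(ltnW ir) //.
exact: coord_sum_regular.
Qed.

End CoordinateModules.

(** * Hilbert depth of the edge ideal quotient *)

Section EdgeIdealQuotient.
Variables (K : fieldType) (n m : nat).
Local Notation S := {mpoly K[n + m]}.
Local Notation Q := (quot_graded (@xy_gens_homog K n m)).

Definition xy_mons : seq 'X_{1..n + m} :=
  [seq (U_(lshift m i) + U_(rshift n j))%MM | i <- enum 'I_n, j <- enum 'I_m].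

Lemma xy_gensE : xy_gens K n m = [seq 'X_[a] | a <- xy_mons].
Proof.
by rewrite map_allpairs; apply: eq_allpairs => i j; rewrite mpolyXD.
Qed.

(** A monomial avoids every x_i y_j exactly when it involves only x's or only y's. The two families
    share only the monomial 1, which is the source of the -1 in [edge_dim]. *)
Lemma standard_xy a : standard xy_mons a =
  predU (mnm_supported [set l : 'I_(n + m) | (l < n)%N])
        (mnm_supported (~: [set l : 'I_(n + m) | (l < n)%N])) a.
Proof.
rewrite /standard -all_predC; apply/idP/orP => [/allP h|h].
  have [|/forallPn[l]] := boolP (mnm_supported (~: [set l : 'I_(n + m) | (l < n)%N]) a).
    by right.
  rewrite !inE negbK negb_imply => /andP[ln al]; left; apply/forallP => l'.
  rewrite inE -leqNgt; apply/implyP => nl'; apply: contraT => al'.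
  have mm : (l' - n < m)%N by have := ltn_ord l'; lia.
  have e : l = lshift m (Ordinal ln) by apply: val_inj.
  have e' : l' = rshift n (Ordinal mm) by apply: val_inj; rewrite /= subnKC.
  have lx : (U_(l) + U_(l'))%MM \in xy_mons.
    by apply/allpairsP; exists (Ordinal ln, Ordinal mm); rewrite !mem_enum -e -e'.
  have /negP[] := h _ lx; apply/mnm_lepP => j; rewrite mnmDE !mnm1E.
  have ne : l != l' by apply: contraTneq nl' => <-; rewrite -ltnNge.
  have [<-|_] := eqVneq l j; first by rewrite eq_sym (negPf ne) addn0 lt0n.
  by have [<-|_] := eqVneq l' j; rewrite ?lt0n.
apply/allP => _ /allpairsP[[i j] /= [_ _ ->]]; apply/negP => /mnm_lepP le.
have [li lj] : a (lshift m i) != 0%N /\ a (rshift n j) != 0%N.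
  by move: (le (lshift m i)) (le (rshift n j)); rewrite !mnmDE !mnm1E !eqxx; lia.
case: h => /forallP h.
  by have := h (rshift n j); rewrite inE /= ltnNge leq_addr (negPf lj).
by have := h (lshift m i); rewrite !inE /= ltn_ord (negPf li).
Qed.

Lemma xy_count d : (mnm_count (standard xy_mons) d)%:Z = edge_dim n m d.
Proof.
set J := [set l : 'I_(n + m) | (l < n)%N].
have cJ : #|J| = n by rewrite card_ord_lt // leq_addr.
have cJ' : #|~: J| = m by rewrite cardsCs finset.setCK cJ card_ord addKn.
have cI : mnm_count (predI (mnm_supported J) (mnm_supported (~: J))) d =
    mnm_count (mnm_supported (finset.set0 : {set 'I_(n + m)})) d.
  apply: eq_mnm_count => a /=; apply/andP/forallP => [[/forallP h /forallP h'] l|h].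
    by move: (h l) (h' l); rewrite !inE; case: (_ < _)%N.
  by split; apply/forallP => l; have := h l; rewrite inE /= => ->; rewrite implybT.
have := mnm_countU (mnm_supported J) (mnm_supported (~: J)) d.
rewrite -(eq_mnm_count standard_xy) cI => /(congr1 Posz);
  rewrite !PoszD !mnm_count_supported.
by rewrite cJ cJ' cards0 /edge_dim => <-; rewrite addrK.
Qed.

Lemma xy_hilbert (d : nat) : (hilbert_series Q d%:Z)%:Z = edge_dim n m d.
Proof.
have [b /hilbert_seriesE ->] := quot_graded_basis (@xy_gens_homog K n m) xy_gensE d%:Z.
exact: xy_count.
Qed.

Lemma xy_hilbert_neg (d : nat) : hilbert_series Q (Negz d) = 0%N.
Proof.
by have [b /hilbert_seriesE ->] := quot_graded_basis (@xy_gens_homog K n m) xy_gensE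
  (Negz d).
Qed.

Hypotheses (m_gt0 : (0 < m)%N) (m_le_n : (m <= n)%N).

Section SameHilbertSeries.
Variable N : gradedModule K (n + m).
Hypotheses (N_fg : finitely_generated N) (N_hs : hilbert_series N = hilbert_series Q).

Lemma regular_seq_edge_positive (fs : seq S) :
  {in fs, forall f : S, f@_0%MM = 0} -> regular_seq N fs -> positive n m (size fs).
Proof.
move=> f0 reg d.
have neg : hilbert_series N (-1) = 0%N by rewrite N_hs; exact: (xy_hilbert_neg 0).
have := regular_seq_positive N_fg neg f0 reg d.
rewrite (eq_iter_diff _ (g := edge_dim n m)) // => e.
by rewrite N_hs xy_hilbert.
Qed.

Lemma positive0 : positive n m 0.
Proof. by move=> d /=; rewrite -xy_hilbert. Qed.

(** An unbounded set has supremum 0 by default; [positive_leq] supplies the bound n that makes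
    [depth] an upper bound. *)
Lemma leq_depth (fs : seq S) : {in fs, forall f : S, f@_0%MM = 0} -> regular_seq N fs ->
  (size fs <= depth N)%N.
Proof.
move=> f0 reg; apply: (leq_nat_supremum (B := n)) => [_ [gs [g0 greg ->]]|];
  last by exists fs.
exact/(positive_leq m_gt0 m_le_n)/regular_seq_edge_positive.
Qed.

Lemma depth_positive : positive n m (depth N).
Proof.
apply: nat_supremum_ind => [|_ [gs [g0 greg ->]]]; first exact: positive0.
exact: regular_seq_edge_positive.
Qed.

End SameHilbertSeries.

Lemma h_positive : positive n m (h K n m).
Proof.
apply: nat_supremum_ind => [|_ [N [N_fg N_hs ->]]]; first exact: positive0.
exact: depth_positive.
Qed.

(** Together with [h_positive] this identifies h with the largest r such that [positive n m r];
    everything after it is numerical. *)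
Lemma leq_h r : positive n m r -> (r <= h K n m)%N.
Proof.
move=> pos; have rn := positive_leq m_gt0 m_le_n pos.
have [l lr el] := positive_decomposition rn m_le_n pos.
have lk : {in l, forall x, (x.2 <= n + m)%N}.
  by move=> x /lr /andP[_ le]; rewrite (leq_trans le) ?leq_addr.
have rk : (r <= n + m)%N by rewrite (leq_trans rn) ?leq_addr.
pose N := coord_sum K (n + m) l.
have N_fg : finitely_generated N by exact: coord_sum_fg.
have N_hs : hilbert_series N = hilbert_series Q.
  apply/funext => d; apply/eqP; rewrite -eqz_nat.
  have [s [b [/hilbert_seriesE -> ->]]] := coord_sum_basis K d lk.
  by case: d {s b} => d; rewrite ?xy_hilbert ?xy_hilbert_neg // el.
(* The empty sum is excluded because H has constant coefficient 1. *)
have l0 : l != [::].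
  by apply/eqP => l0; have := el 0%N; rewrite l0 big_nil /edge_dim /poly_dim !bin0.
have reg : regular_seq N (vars K (n + m) r).
  by apply: coord_sum_regular_seq => // x /lr /andP[].
have f0 : {in vars K (n + m) r, forall f : S, f@_0%MM = 0}.
  by move=> f /mapP[j _ ->]; rewrite mcoeffX mnm1_eq0.
apply: (@leq_trans (depth N)).
  by rewrite -{1}(size_vars K rk); exact: leq_depth.
apply: (leq_nat_supremum (B := n)) => [_ [N' [N'_fg N'_hs ->]]|]; last by exists N.
exact/(positive_leq m_gt0 m_le_n)/depth_positive.
Qed.

End EdgeIdealQuotient.

Theorem theorem3p3 (K : fieldType) (n : nat) (hn : (1 <= n)%N) :
  (forall m m' : nat, (1 <= m)%N -> (m <= m')%N -> (m' <= n./2)%N ->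
     (h K n m' <= h K n m)%N) /\
  (forall m m' : nat, (uphalf n <= m)%N -> (m <= m')%N -> (m' <= n)%N ->
     (h K n m <= h K n m')%N) /\
  ((2 <= n)%N -> h K n n./2 = h K n (uphalf n) /\ h K n (uphalf n) = uphalf n) /\
  (forall m : nat, (1 <= m)%N -> (m <= n./2)%N ->
     (h K n (n - m)%N <= h K n m)%N) /\
  (forall m : nat, (1 <= m)%N -> (m <= n)%N ->
     (n./2 <= h K n m)%N /\ (h K n m <= h K n 1)%N).
Proof.
have pos m : (1 <= m)%N -> (m <= n)%N -> positive n m (h K n m).
  by move=> _ _; exact: h_positive.
have max m r : (1 <= m)%N -> (m <= n)%N -> positive n m r -> (r <= h K n m)%N.
  by move=> *; exact: leq_h.
have le_n m : (1 <= m)%N -> (m <= n)%N -> (h K n m <= n)%N.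
  by move=> m0 mn; apply: (positive_leq m0 mn); exact: pos.
have half m : (1 <= m)%N -> (m <= n)%N -> (uphalf n <= h K n m)%N.
  by move=> m0 mn; apply: max => //; exact: positive_uphalf.
have le_m m : (uphalf n <= m)%N -> (m <= n)%N -> (h K n m <= m)%N.
  by move=> nm mn; apply: (positive_leq_uphalf hn nm mn); apply: pos => //; lia.
(* The value r = h(n, m') satisfies m' <= n/2 <= r, as [positive_decrease] requires. *)
have decr m m' : (1 <= m)%N -> (m <= m')%N -> (m' <= n./2)%N -> (h K n m' <= h K n m)%N.
  move=> m0 mm' m'n; apply: max => //; first lia.
  apply: (positive_decrease mm' _ _ (pos m' _ _)); rewrite ?le_n //; try lia.
  by apply: leq_trans (half m' _ _); lia.
(* The bound n + 1, and not n, matters: (4) takes m' = n - m, but (5) compares m' up to n with 1. *)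
have swap m m' : (1 <= m)%N -> (m <= uphalf n)%N -> (uphalf n <= m')%N -> (m' <= n)%N ->
    (m + m' <= n.+1)%N -> (h K n m' <= h K n m)%N.
  move=> m0 mn nm' m'n le; apply: max => //; first lia.
  apply: (positive_swap _ (le_m m' nm' m'n) (le_n m' _ m'n) le (pos m' _ m'n)); try lia.
  by apply: leq_trans mn (half m' _ _); lia.
split=> //; split=> [m m' nm mm' m'n|].
  (* Here r = h(n, m) <= m by [le_m], as [positive_increase] requires. *)
  by apply: max; try lia; apply: (positive_increase _ mm' (pos m _ _));
    rewrite ?le_m //; lia.
split=> [n2|].
  have e : h K n (uphalf n) = uphalf n.
    by apply/eqP; rewrite eqn_leq le_m ?half //; lia.
  rewrite e; split=> //; apply/eqP; rewrite eqn_leq half; try lia.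
  by rewrite andbT; apply: (positive_leq_half n2); apply: pos; lia.
split=> [m m0 mn|m m0 mn]; first by apply: swap; lia.
split; first by apply: leq_trans (half m m0 mn); lia.
by have [le|gt] := leqP m n./2; [exact: decr|apply: swap; lia].
Qed.
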